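(* Let $\mathtt{Alg}$ be any sequential algorithm, let all batches have the same size $n_k=m>0$, and let $P\in\mathcal P(\Theta)$ be a data-independent prior. For any $\lambda>0$ and $\delta\in(0,1]$, with probability at least $1-\delta$ over $S$, the following holds simultaneously for all $k\ge 0$ and all $Q\in\mathcal P(\Theta)$, where $\pi_{j+1}$ denotes the output of $\mathtt{Alg}$ at time $j$ (and the estimator below is built from $\pi_0,\dots,\pi_k$): $$R(\pi_Q)\le \hat R^{\lambda\text{-}\mathrm{LS}}_{0:k}(\pi_Q)+\frac{\operatorname{KL}(Q,P)+\log\frac1\delta}{\lambda (k+1)m}.$$
   Context: Contextual bandit: $\mathcal X\subset\mathbb R^d$ is a compact context space, $\mathcal A=\{1,\dots,K\}$ a finite action set, a policy $\pi$ maps each $x\in\mathcal X$ to a probability distribution $\pi(\cdot\mid x)$ on $\mathcal A$. Contexts have an unknown law $\nu$ on $\mathcal X$; given context $x$ and action $a$, the cost $c\in[-1,0]$ is drawn from an unknown law $p(\cdot\mid x,a)$ with mean $c(a,x)$. The risk of $\pi$ is $R(\pi)=\mathbb E_{x\sim\nu,\,a\sim\pi(\cdot\mid x)}[c(a,x)]$. Sequential data: $\pi_0$ is a fixed initial policy. At time $k\ge 0$ the current policy $\pi_k$ collects a batch $S_k=\{(x_i,a_i,c_i): i\in I_k\}$, $|I_k|=n_k$, with the index sets $I_k$ disjoint; $\mathcal F_k$ is the $\sigma$-algebra generated by $S_0,\dots,S_k$ ($\mathcal F_{-1}$ trivial), and $S=\bigcup_k S_k$. Conditionally on $\mathcal F_{k-1}$,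 the triples in $S_k$ are mutually independent with $x_i\sim\nu$, $a_i\sim\pi_k(\cdot\mid x_i)$, $c_i\sim p(\cdot\mid x_i,a_i)$. A sequential algorithm is one whose output $\pi_{k+1}$ at time $k$ is $\mathcal F_k$-measurable (a function of $S_0\cup\dots\cup S_k$); $\pi_{k+1}$ then collects $S_{k+1}$. Policy parametrization: $\Theta$ is a parameter space, $f_\theta:\mathcal X\to\mathcal A$ for $\theta\in\Theta$ are predictors, $\mathcal P(\Theta)$ is the set of probability distributions on $\Theta$; for $Q\in\mathcal P(\Theta)$, $\pi_Q(a\mid x)=\mathbb E_{\theta\sim Q}[\mathbf 1\{f_\theta(x)=a\}]$. $\operatorname{KL}(Q,P)=\mathbb E_Q[\log(dQ/dP)]$ is the Kullback–Leibler divergence ($+\infty$ if $Q\not\ll P$). Logarithmic smoothing estimator (here with all $n_j=m$): $$\hat R^{\lambda\text{-}\mathrm{LS}}_{0:k}(\pi)=-\frac{1}{(k+1)m}\sum_{j=0}^k\sum_{i\in I_j}\frac{\pi(a_i\mid x_i)}{\lambda}\log\Big(1-\frac{\lambda c_i}{\pi_j(a_i\mid x_i)}\Big).$$ *)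

(* Defs.v *)
From HB Require Import structures.
From mathcomp Require Import all_boot all_order all_algebra.
From mathcomp Require Import all_classical all_reals all_analysis.

Set Implicit Arguments.
Unset Strict Implicit.
Unset Printing Implicit Defensive.

Import Order.TTheory GRing.Theory Num.Theory.
Import numFieldNormedType.Exports.

Local Open Scope classical_set_scope.
Local Open Scope ring_scope.

(* The action set {1, ..., K+1}, with the discrete sigma-algebra. *)
Definition action (K : nat) := 'I_K.+1.

HB.instance Definition _ K := Finite.on (action K).
HB.instance Definition _ K := isPointed.Build (action K) ord0.
HB.instance Definition _ K := @isMeasurable.Build default_measure_display
  (action K) discrete_measurable discrete_measurable0
  discrete_measurableC discrete_measurableU.

(* [borel X0] is the set X seen as a type, with the Borel sigma-algebra of its
   subspace topology. The library's measurable types are pointed, whence the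
   proof X0 of nonemptiness. *)
Section borel.
Context {R : realType} {d : nat} {X : set 'rV[R]_d} (X0 : X !=set0).

Definition context_point : Type := let _ := X0 in set_type X.

HB.instance Definition _ := Choice.copy context_point (set_type X).
HB.instance Definition _ := isPointed.Build context_point
  (exist _ (sval (cid X0)) (mem_set (svalP (cid X0)))).

Definition borel := g_sigma_algebraType (@open X : set (set context_point)).
HB.instance Definition _ := Measurable.on borel.

End borel.

Section conditioning.
Context {R : realType} {dO : measure_display} {Omega : measurableType dO}.
Variables (Pr : probability Omega R) (G : set (set Omega)).

(* g is a version of the conditional probability of E given G. *)
Definition is_cond_prob (E : set Omega) (g : Omega -> R) : Prop :=
  [/\ forall B : set R, measurable B -> G (g @^-1` B),
      Pr.-integrable setT (EFin \o g) &
      forall F, G F -> (\int[Pr]_(w in F) (g w)%:E = Pr (F `&` E))%E].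

(* q w B is a version of P(Z in B | G), for every measurable B. *)
Definition has_cond_law {dT : measure_display} {T : measurableType dT}
    (Z : Omega -> T) (q : Omega -> set T -> R) : Prop :=
  forall B, measurable B -> is_cond_prob (Z @^-1` B) (fun w => q w B).

(* The choice B i = setT reduces subfamilies to the whole family. *)
Definition cond_mutually_independent {dT : measure_display}
    {T : measurableType dT} {m : nat} (Z : 'I_m -> Omega -> T) : Prop :=
  forall (B : 'I_m -> set T) (g : 'I_m -> Omega -> R),
    (forall i, measurable (B i)) ->
    (forall i, is_cond_prob (Z i @^-1` B i) (g i)) ->
    is_cond_prob (\bigcap_i (Z i @^-1` B i)) (fun w => \prod_i g i w).

End conditioning.

Section kullback_leibler.
Context {R : realType} {d : measure_display} {T : measurableType d}.
Local Open Scope ereal_scope.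
Local Open Scope charge_scope.

Definition KL (Q P : probability T R) : \bar R :=
  if `[< Q `<< P >]
  then \int[Q]_t lne (('d (charge_of_finite_measure Q) '/d P) t)
  else +oo.

End kullback_leibler.

Section bandit.
Context {R : realType} {dX : measure_display} {X : measurableType dX}.
Context {K m : nat}.
Local Notation A := (action K).

(* A policy is given by its mass functions: pi x a is pi(a | x). *)
Definition policy := X -> A -> R.

Definition is_policy (pi : policy) : Prop :=
  (forall a, measurable_fun setT (fun x => pi x a)) /\
  (forall x, (forall a, 0 <= pi x a) /\ \sum_a pi x a = 1).

Definition sample : Type := X * A * R.

Definition batch : Type := m.-tuple sample.

Variables (nu : probability X R) (p : R.-pker (X * A) ~> R).

Definition mean_cost (a : A) (x : X) : R := \int[p (x, a)]_c c.

Definition risk (pi : policy) : R :=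
  \int[nu]_x (\sum_a pi x a * mean_cost a x).

(* The law of (x, a, c) when x ~ nu, a ~ pi(. | x), c ~ p(. | x, a). *)
Definition sample_law (pi : policy) (B : set sample) : R :=
  \int[nu]_x (\sum_a pi x a * fine (p (x, a) [set c | B (x, a, c)])).

Section predictors.
Context {dT : measure_display} {Theta : measurableType dT}.

Definition policy_of (f : Theta -> X -> A) (Q : probability Theta R) : policy :=
  fun x a => \int[Q]_t (f t x == a)%:R.

End predictors.

(* alg k S_0 ... S_k is the policy pi_(k+1); the joint measurability makes
   pi_(k+1)(a | x) a measurable function of the data and of x. *)
Definition algorithm := forall k : nat, k.+1.-tuple batch -> policy.

Definition is_algorithm (alg : algorithm) : Prop :=
  (forall k h, is_policy (alg k h)) /\
  (forall k a, measurable_fun setT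
     (fun hx : k.+1.-tuple batch * X => alg k hx.1 hx.2 a)).

Section data.
Context {dO : measure_display} {Omega : measurableType dO}.
(* z k i is the i-th triple of the batch S_k. *)
Variables (Pr : probability Omega R) (z : nat -> 'I_m -> Omega -> sample).
Variables (pi0 : policy) (alg : algorithm).

Definition batch_at (k : nat) (w : Omega) : batch := [tuple z k i w | i < m].

Definition history (k : nat) (w : Omega) : k.+1.-tuple batch :=
  [tuple batch_at j w | j < k.+1].

(* The sigma-algebra F_(k-1). *)
Definition past (k : nat) : set (set Omega) :=
  if k is j.+1 then preimage_set_system setT (history j) measurable
  else [set set0; setT].

Definition policy_at (k : nat) (w : Omega) : policy :=
  if k is j.+1 then alg (history j w) else pi0.

Definition sequential_data : Prop :=
  (forall k i, measurable_fun setT (z k i)) /\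
  (forall k,
    cond_mutually_independent Pr (past k) (z k) /\
    forall i, has_cond_law Pr (past k) (z k i)
                (fun w => sample_law (policy_at k w))).

(* x / 0 = 0 by convention; the denominators vanish on a null set only. *)
Definition LS_estimator (lambda : R) (k : nat) (w : Omega) (pi : policy) : R :=
  - ((k.+1 * m)%:R)^-1 *
    \sum_(j < k.+1) \sum_(i < m)
      let: (x, a, c) := z j i w in
      pi x a / lambda * ln (1 - lambda * c / policy_at j w x a).

End data.
End bandit.

Arguments policy {R dX} X K.
Arguments sample {R dX} X K.
Arguments batch {R dX} X K m.
Arguments algorithm {R dX} X K m.

(* Main.v *)
(** For a fixed predictor f_t of risk r(t), the process
      M_k(t) = exp (sum over the samples (x, a, c) of the first k batches of
                      lambda r(t) + 1{f_t(x) = a} ln (1 - lambda c / pi_j(a | x)))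
    is a nonnegative supermartingale: given the past, importance weighting makes
    the mean of 1 - lambda 1{f_t(x) = a} c / pi_j(a | x) at most
    1 - lambda r(t) <= exp (- lambda r(t)). So is its mixture N_k, the integral of
    M_k(t) against the prior P, and Ville's inequality gives N_k <= 1 / delta for
    all k at once with probability at least 1 - delta. On that event the
    Donsker-Varadhan inequality bounds the Q-mean of ln M_k(t), which is
    lambda k m (R(pi_Q) - LS), by KL(Q, P) + ln (1 / delta). *)

Require Import Defs.
From HB Require Import structures.
From mathcomp Require Import all_boot all_order all_algebra.
From mathcomp Require Import all_classical all_reals all_analysis.
From mathcomp Require Import measurable_realfun ring lra.

Set Implicit Arguments.
Unset Strict Implicit.
Unset Printing Implicit Defensive.

Import Order.TTheory GRing.Theory Num.Theory.
Import numFieldNormedType.Exports.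

Local Open Scope classical_set_scope.
Local Open Scope ring_scope.

(** The logarithm in the estimator is such that exponentiation undoes it: the factor
    [1 - lambda c / pi_j] is affine in the importance weight, so only a first moment enters. The
    indicator of [f_t(x) = a], being 0 or 1, may stand outside the logarithm without changing the
    exponential; there the log-weight is linear in it, and its Q-mean is, up to normalization, the
    term of the estimator with [pi_Q(a | x)]. Ville's inequality concerns the prior mixture alone,
    so the event is fixed before [k] and [Q], and [Q] may depend on the data.

    The obstacle is the form of the assumption on the data. It gives probabilities of events: a past
    event together with conditions [z_i in B_i]. The supermartingale inequality needs integrals of
    functions of the past and of the samples jointly. The passage is a uniqueness principle:
    positive, homogeneous, countably additive functionals of finite mass that agree on a generating
    pi-system agree on all nonnegative measurable functions. Conditional expectations are replaced
    throughout by integrals against indicators of past events. *)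

(** * Daniell functionals and the measures behind them *)

Section integral_like.
Context {R : realType}.
Local Open Scope ereal_scope.

Definition nonneg_measurable d (T : measurableType d) (f : T -> \bar R) :=
  measurable_fun setT f /\ forall x, 0 <= f x.

(* Daniell's point of view: such a functional is the integral against a measure.
   Being closed under sums and integrals, they give access to iterated integrals
   without building the corresponding product kernels. *)
Definition integral_like d (T : measurableType d) (I : (T -> \bar R) -> \bar R) :=
  [/\ forall f, nonneg_measurable f -> 0 <= I f,
      forall r f, (0 <= r)%R -> nonneg_measurable f ->
        I (fun x => r%:E * f x) = r%:E * I f &
      forall f : nat -> T -> \bar R, (forall n, nonneg_measurable (f n)) ->
        I (fun x => \sum_(n <oo) f n x) = \sum_(n <oo) I (f n)].

Lemma nonneg_measurable_indic d (T : measurableType d) (A : set T) :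
  measurable A -> nonneg_measurable (fun x => (\1_A x)%:E : \bar R).
Proof.
move=> mA; split; last by move=> x; rewrite lee_fin.
exact/measurable_EFinP.
Qed.

Lemma nonneg_measurable_comp d d' (T : measurableType d) (U : measurableType d')
    (f : U -> \bar R) (phi : T -> U) :
  measurable_fun setT phi -> nonneg_measurable f -> nonneg_measurable (f \o phi).
Proof. by move=> mphi [mf f0]; split=> [|x /=//]; exact: measurableT_comp. Qed.

Lemma integral_like_eval d (T : measurableType d) (x : T) :
  integral_like (fun f : T -> \bar R => f x).
Proof. by split=> // f []. Qed.

Lemma integral_like_scale d (T : measurableType d) I (c : R) : (0 <= c)%R ->
  integral_like (T := T) I -> integral_like (T := T) (fun f => c%:E * I f).
Proof.
move=> c0 [I0 IZ IS]; split=> [f hf|r f r0 hf|f hf].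
- by rewrite mule_ge0// I0.
- by rewrite IZ// muleCA.
- by rewrite IS// nneseriesZl// => n _; exact: I0.
Qed.

Lemma integral_like_sum d (T : measurableType d) (J : finType) I :
  (forall j, integral_like (T := T) (I j)) ->
  integral_like (T := T) (fun f => \sum_(j : J) I j f).
Proof.
move=> hI; split=> [f hf|r f r0 hf|f hf].
- by apply: sume_ge0 => j _; have [+ _ _] := hI j; exact.
- rewrite ge0_sume_distrr; last by move=> j _; have [+ _ _] := hI j; exact.
  by apply: eq_bigr => j _; have [_ + _] := hI j; exact.
- rewrite nneseries_sum; last by move=> j n _; have [+ _ _] := hI j; exact.
  by apply: eq_bigr => j _; have [_ _ +] := hI j; exact.
Qed.

Lemma integral_like_integral d d' (T : measurableType d) (Y : measurableType d')
    (mu : {measure set Y -> \bar R}) D I : measurable D ->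
  (forall y, D y -> integral_like (T := T) (I y)) ->
  (forall f, nonneg_measurable f -> measurable_fun D (I ^~ f)) ->
  integral_like (T := T) (fun f => \int[mu]_(y in D) I y f).
Proof.
move=> mD hI mI.
have I0 f y : nonneg_measurable f -> D y -> 0 <= I y f.
  by move=> hf Dy; have [+ _ _] := hI y Dy; exact.
split=> [f hf|r f r0 hf|f hf].
- by apply: integral_ge0 => y Dy; exact: I0.
- rewrite -ge0_integralZl//; [|exact: mI|by move=> y Dy; exact: I0].
  by apply: eq_integral => y /set_mem Dy; have [_ + _] := hI y Dy; exact.
- rewrite -integral_nneseries//; [|by move=> n; exact: mI|by move=> n y Dy; exact: I0].
  by apply: eq_integral => y /set_mem Dy; have [_ _ +] := hI y Dy; exact.
Qed.

Lemma integral_like_comp d d' (T : measurableType d) (U : measurableType d')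
    I (phi : T -> U) : measurable_fun setT phi -> integral_like (T := T) I ->
  integral_like (T := U) (fun f => I (f \o phi)).
Proof.
move=> mphi [I0 IZ IS]; split=> [f hf|r f r0 hf|f hf].
- exact/I0/nonneg_measurable_comp.
- exact/(IZ r (f \o phi))/nonneg_measurable_comp.
- by rewrite -IS// => n; exact: nonneg_measurable_comp.
Qed.

Section theory.
Context d (T : measurableType d) (I : (T -> \bar R) -> \bar R).
Hypothesis hI : integral_like I.

Lemma integral_like0 : I (cst 0) = 0.
Proof.
have [_ IZ _] := hI; have := IZ 0%R (cst 0).
by under eq_fun do rewrite mul0e; rewrite mul0e; apply => //; split.
Qed.

(** A finite sum is a series padded with zero functions, and [integral_like0], which is homogeneity
    at the scalar 0, removes the padding. *)
Lemma integral_like_fsum (J : choiceType) (f : J -> T -> \bar R) (A : set J) :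
  finite_set A -> (forall j, nonneg_measurable (f j)) ->
  I (fun x => \sum_(j \in A) f j x) = \sum_(j \in A) I (f j).
Proof.
move=> fA hf; have [I0 _ IS] := hI.
under eq_fun do rewrite fsbig_finite//=.
rewrite fsbig_finite//=; move: (finmap.enum_fset (fset_set A)) => s {A fA}.
have [->|s0] := eqVneq s [::].
  by under eq_fun do rewrite big_nil; rewrite big_nil integral_like0.
case: s s0 => // j0 s' _; set s := j0 :: s'.
pose h n := if (n < size s)%N then f (nth j0 s n) else cst 0.
have hh n : nonneg_measurable (h n).
  by rewrite /h; case: ifP => // _; split.
have aux (u : nat -> \bar R) : (forall n, (size s <= n)%N -> u n = 0) ->
    (forall n, 0 <= u n) -> \sum_(n <oo) u n = \sum_(i < size s) u i.
  move=> uE u0; rewrite (nneseries_split 0 (size s))// add0n.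
  by rewrite big_mkord eseries0 ?adde0// => n ns _; exact: uE.
have hE n : (size s <= n)%N -> h n = cst 0.
  by move=> sn; rewrite /h ltnNge sn.
transitivity (I (fun x => \sum_(n <oo) h n x)).
  congr I; apply/funext => x; rewrite aux; last 2 first.
    by move=> n /hE ->.
    by move=> n; exact: (hh n).2.
  by rewrite (big_nth j0) big_mkord; apply: eq_bigr => i _; rewrite /h ltn_ord.
rewrite IS// aux; last 2 first.
  by move=> n /hE ->; exact: integral_like0.
  by move=> n; exact: I0.
by rewrite (big_nth j0) big_mkord; apply: eq_bigr => i _; rewrite /h ltn_ord.
Qed.

(** A measure must be nonnegative at every set, whereas [I] is controlled on measurable functions
    only; hence the value 0 at the other sets. *)
Let I_indic (A : set T) := if pselect (measurable A) then I (fun x => (\1_A x)%:E) else 0.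

Let I_indicE A : measurable A -> I_indic A = I (fun x => (\1_A x)%:E).
Proof. by rewrite /I_indic; case: pselect. Qed.

Let I_indic0 : I_indic set0 = 0.
Proof.
rewrite I_indicE// -[RHS]integral_like0; congr I.
by apply/funext => x; rewrite indic0.
Qed.

Let I_indic_ge0 A : 0 <= I_indic A.
Proof.
rewrite /I_indic; case: pselect => // mA; have [+ _ _] := hI.
by apply; exact: nonneg_measurable_indic.
Qed.

Let I_indic_semi_sigma_additive : semi_sigma_additive I_indic.
Proof.
move=> F mF tF mUF; rewrite I_indicE//.
rewrite (_ : I _ = \sum_(n <oo) I_indic (F n)).
  by apply: is_cvg_nneseries => n _ _; exact: I_indic_ge0.
have [_ _ IS] := hI.
transitivity (I (fun x => \sum_(n <oo) (\1_(F n) x)%:E)).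
  by congr I; apply/funext => x; rewrite indic_bigcup.
rewrite IS; last by move=> n; exact: nonneg_measurable_indic.
by apply: eq_eseriesr => n _; rewrite I_indicE.
Qed.

Lemma integral_like_measure : exists mu : {measure set T -> \bar R},
  forall A, measurable A -> mu A = I (fun x => (\1_A x)%:E).
Proof.
pose mixin := isMeasure.Build d T R I_indic I_indic0 I_indic_ge0 I_indic_semi_sigma_additive.
pose m : {measure set T -> \bar R} := HB.pack I_indic mixin.
by exists m.
Qed.

Import HBNNSimple.

Let integral_like_simple (mu : {measure set T -> \bar R}) (h : T -> R) :
  (forall A, measurable A -> mu A = I (fun x => (\1_A x)%:E)) ->
  measurable_fun setT h -> finite_set (range h) -> (forall x, (0 <= h x)%R) ->
  I (EFin \o h) = \int[mu]_x (h x)%:E.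
Proof.
move=> muE mh fh h0.
pose mixin := FiniteImage.Build _ _ h fh.
pose hf : {fimfun T >-> R} := HB.pack h mixin.
(* Homogeneity holds for nonnegative scalars, and [hg] is wanted at every real [r]; on the range of
   [h] the coefficient is [r] itself. *)
pose g r x := ((Num.max r 0)%:E * (\1_(h @^-1` [set r]) x)%:E) : \bar R.
have mpre r : measurable (h @^-1` [set r]).
  by rewrite -[X in measurable X]setTI; exact: mh.
have gE x : (h x)%:E = \sum_(r \in range h) g r x.
  rewrite -[h x]/(hf x) fimfunE -fsumEFin//; apply: eq_fsbigr => r.
  by rewrite inE => -[y _ <-]; rewrite /g EFinM (max_idPl (h0 y)).
have hg r : nonneg_measurable (g r).
  split; last by move=> x; rewrite mule_ge0// lee_fin// le_max lexx orbT.
  by apply: emeasurable_funM => //; exact/measurable_EFinP.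
transitivity (I (fun x => \sum_(r \in range h) g r x)).
  by congr I; apply/funext => x /=; exact: gE.
under [RHS]eq_integral do rewrite gE.
rewrite integral_like_fsum// ge0_integral_fsum//; last 2 first.
- by move=> r; exact: (hg r).1.
- by move=> r x _; exact: (hg r).2.
apply: eq_fsbigr => r _; have [_ IZ _] := hI.
rewrite IZ; [|by rewrite le_max lexx orbT|exact: nonneg_measurable_indic].
rewrite ge0_integralZl//; last 2 first.
- exact/measurable_EFinP.
- by rewrite lee_fin le_max lexx orbT.
by rewrite integral_indic// setIT muE.
Qed.

(** Countable additivity replaces monotone convergence: a nonnegative function is the sum of the
    successive differences of its increasing simple approximations, and each difference is again
    nonnegative with finite range. *)
Lemma integral_like_integralE : exists mu : {measure set T -> \bar R},
  forall f, nonneg_measurable f -> I f = \int[mu]_x f x.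
Proof.
have [mu muE] := integral_like_measure; exists mu => f [mf f0].
pose h : {nnsfun T >-> R}^nat := nnsfun_approx measurableT mf.
pose g n (x : T) : R := if n is k.+1 then (h k.+1 x - h k x)%R else h 0%N x.
have ndh x : nondecreasing_seq (h ^~ x).
  by move=> i j ij; exact/lefP/nd_nnsfun_approx.
have g0 n x : (0 <= g n x)%R.
  by case: n => [|n] //=; rewrite subr_ge0; exact: ndh.
have mg n : measurable_fun setT (g n).
  by case: n => [|n] /=; [exact: measurable_funP|exact: measurable_funB].
have fg n : finite_set (range (g n)).
  case: n => [|n] /=; first exact: fimfunP.
  exact: (fimfunP ((h n.+1 : {fimfun T >-> R}) - (h n : {fimfun T >-> R}))%R).
have sg x n : (\sum_(0 <= i < n.+1) (g i x)%:E) = (h n x)%:E.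
  elim: n => [|n IH]; first by rewrite big_nat1.
  by rewrite big_nat_recr//= IH -EFinD addrC subrK.
have fE x : f x = \sum_(n <oo) (g n x)%:E.
  apply/esym/cvg_lim => //; rewrite -cvg_shiftS.
  under eq_fun do rewrite sg.
  exact: cvg_nnsfun_approx.
have hg n : nonneg_measurable (EFin \o g n).
  by split=> [|x]; [exact/measurable_EFinP|rewrite lee_fin].
have [_ _ IS] := hI.
transitivity (I (fun x => \sum_(n <oo) (g n x)%:E)).
  by congr I; apply/funext => x; rewrite fE.
under [RHS]eq_integral do rewrite fE.
rewrite (IS (fun n => EFin \o g n))// integral_nneseries//; last 2 first.
- by move=> n; exact: (hg n).1.
- by move=> n x _; rewrite lee_fin.
by apply: eq_eseriesr => n _; exact: integral_like_simple.
Qed.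

End theory.

(** Once both functionals are measures, this is uniqueness on a pi-system. Since [setT] is in [G]
    and [I] has finite mass, the constant sequence [setT] serves as the exhausting sequence. *)
Lemma integral_like_unique d (T : measurableType d) (G : set (set T))
    (I J : (T -> \bar R) -> \bar R) :
  integral_like I -> integral_like J ->
  measurable = <<s G >> -> setI_closed G -> G setT ->
  I (cst 1) < +oo ->
  (forall A, G A -> I (fun x => (\1_A x)%:E) = J (fun x => (\1_A x)%:E)) ->
  forall f, nonneg_measurable f -> I f = J f.
Proof.
move=> hI hJ mG GI GT I1 IJ f hf.
have [mu muE] := integral_like_integralE hI.
have [mu' muE'] := integral_like_integralE hJ.
rewrite muE// muE'//; apply: eq_measure_integral => A mA _.
have muA B : measurable B -> mu B = I (fun x => (\1_B x)%:E).
  by move=> mB; rewrite muE ?integral_indic ?setIT//; exact: nonneg_measurable_indic.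
have muA' B : measurable B -> mu' B = J (fun x => (\1_B x)%:E).
  by move=> mB; rewrite muE' ?integral_indic ?setIT//; exact: nonneg_measurable_indic.
apply: (measure_unique G (fun=> setT)) => //.
- by rewrite bigcup_const.
- move=> B GB; have mB : measurable B by rewrite mG; exact: sub_sigma_algebra.
  by rewrite muA// muA'// IJ.
- by move=> _; rewrite muA//; under eq_fun do rewrite indicT.
Qed.
End integral_like.

(** * Kernels reparametrized by a measurable map *)

Section kprecomp.
Context d d' d3 (T : measurableType d) (Y : measurableType d')
  (Z : measurableType d3) (R : realType).
Variables (k : R.-pker Y ~> Z) (phi : T -> Y).

(** With a map such as [(t, x) |-> (x, a)], an integral against [p (x, a)] becomes one against a
    kernel from the space of all parameters, and its measurability in them is the general result on
    kernels. The proof [mphi] is an argument so that the kernel structure attaches to the term. *)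
Definition kprecomp (mphi : measurable_fun setT phi) (t : T) :
  {measure set Z -> \bar R} := k (phi t).

Hypothesis mphi : measurable_fun setT phi.

Let measurable_kprecomp U : measurable U ->
  measurable_fun setT (kprecomp mphi ^~ U).
Proof. by move=> mU; exact: (measurableT_comp (measurable_kernel k U mU) mphi). Qed.

HB.instance Definition _ := isKernel.Build _ _ _ _ _ (kprecomp mphi)
  measurable_kprecomp.

Let kprecomp_setT t : kprecomp mphi t setT = 1%E.
Proof. exact: prob_kernel. Qed.

HB.instance Definition _ := Kernel_isProbability.Build _ _ _ _ _
  (kprecomp mphi) kprecomp_setT.

End kprecomp.

(** * Expectations under the law of one sample *)

Section bandit_integral.
Context {R : realType} {dX : measure_display} {X : measurableType dX} {K : nat}.
Variables (nu : probability X R) (p : R.-pker (X * action K) ~> R).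
Local Open Scope ereal_scope.

Definition bandit_integral (pi : @policy R dX X K) (f : @sample R dX X K -> \bar R) :=
  \int[nu]_x \sum_(a : action K) (pi x a)%:E * \int[p (x, a)]_c f (x, a, c).

Section joint.
Context d (T : measurableType d) (pi : T -> @policy R dX X K) (f : T * @sample R dX X K -> \bar R).
Hypothesis mpi : forall a, measurable_fun setT (fun tx : T * X => pi tx.1 tx.2 a).
Hypothesis pi0 : forall t x a, (0 <= pi t x a)%R.
Hypothesis hf : nonneg_measurable f.

Let inner_measurable a : measurable_fun setT
  (fun tx : T * X => (pi tx.1 tx.2 a)%:E * \int[p (tx.2, a)]_c f (tx.1, (tx.2, a, c))).
Proof.
apply: emeasurable_funM; first exact/measurable_EFinP.
have mphi : measurable_fun setT (fun tx : T * X => (tx.2, a) : X * action K).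
  by apply: measurable_fun_pair.
pose g (y : T * X * R) := f (y.1.1, (y.1.2, a, y.2)).
apply: (measurable_fun_integral_finite_kernel g (kprecomp p mphi)).
  by move=> y; exact: hf.2.
apply: (measurableT_comp hf.1).
apply: measurable_fun_pair.
  exact: (measurableT_comp measurable_fst measurable_fst).
apply: measurable_fun_pair => //; apply: measurable_fun_pair => //.
exact: (measurableT_comp measurable_snd measurable_fst).
Qed.

Lemma measurable_bandit_integral :
  measurable_fun setT (fun t => bandit_integral (pi t) (fun s => f (t, s))).
Proof.
pose F (tx : T * X) := \sum_(a : action K)
  (pi tx.1 tx.2 a)%:E * \int[p (tx.2, a)]_c f (tx.1, (tx.2, a, c)).
apply: (@measurable_fun_fubini_tonelli_F _ _ _ _ _ nu F).
  by apply: emeasurable_sum => a; exact: inner_measurable.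
move=> tx; apply: sume_ge0 => a _; rewrite mule_ge0 ?lee_fin//.
by apply: integral_ge0 => c _; exact: hf.2.
Qed.

End joint.

Lemma measurable_bandit_integrand (pi : @policy R dX X K) f : is_policy pi ->
  nonneg_measurable (f : X * action K * R -> \bar R) ->
  measurable_fun setT
    (fun x => \sum_(a : action K) (pi x a)%:E * \int[p (x, a)]_c f (x, a, c)).
Proof.
move=> [mpi _] [mf f0].
apply: emeasurable_sum => a; apply: emeasurable_funM; first exact/measurable_EFinP.
have mphi : measurable_fun setT (fun x : X => (x, a) : X * action K).
  by apply: measurable_fun_pair.
pose g (y : X * R) := f (y.1, a, y.2).
apply: (measurable_fun_integral_finite_kernel g (kprecomp p mphi)).
  by move=> y; exact: f0.
apply: (measurableT_comp mf).
by apply: measurable_fun_pair => //; apply: measurable_fun_pair.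
Qed.

Lemma le_bandit_integral (pi : @policy R dX X K) f g : is_policy pi ->
  nonneg_measurable (f : X * action K * R -> \bar R) ->
  nonneg_measurable (g : X * action K * R -> \bar R) ->
  (forall s, f s <= g s) -> bandit_integral pi f <= bandit_integral pi g.
Proof.
move=> pip hf hg fg; have [_ pi01] := pip.
have pi0 x a : (0 <= pi x a)%R by have [+ _] := pi01 x; exact.
apply: ge0_le_integral => //.
- move=> x _; apply: sume_ge0 => a _; rewrite mule_ge0 ?lee_fin//.
  by apply: integral_ge0 => c _; exact: hf.2.
- exact: measurable_bandit_integrand.
- exact: measurable_bandit_integrand.
- move=> x _; apply: lee_sum => a _; rewrite lee_wpmul2l ?lee_fin//.
  apply: ge0_le_integral => //.
  + by move=> c _; exact: hf.2.
  + exact: (measurableT_comp hf.1 (pair1_measurable (x, a))).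
  + exact: (measurableT_comp hg.1 (pair1_measurable (x, a))).
Qed.

Lemma integral_like_bandit pi : is_policy pi ->
  integral_like (T := (X * action K * R)%type) (bandit_integral pi).
Proof.
move=> [mpi pi01].
have pi0 x a : (0 <= pi x a)%R by have [+ _] := pi01 x; exact.
apply: (@integral_like_integral _ _ _ _ _ nu setT (fun x f =>
  \sum_(a : action K) (pi x a)%:E * \int[p (x, a)]_c f (x, a, c))) => //.
- move=> x _; apply: (@integral_like_sum _ _ _ (action K) (fun a f =>
    (pi x a)%:E * \int[p (x, a)]_c f (x, a, c))) => a.
  apply: (@integral_like_scale _ _ _ (fun f => \int[p (x, a)]_c f (x, a, c))) => //.
  apply: (@integral_like_integral _ _ _ _ _ (p (x, a)) setT (fun c f =>
    f (x, a, c))) => // [c _|f [mf _]]; first exact: integral_like_eval.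
  exact: (measurableT_comp mf (pair1_measurable (x, a))).
- by move=> f; exact: measurable_bandit_integrand.
Qed.

Lemma bandit_integral_cst1 pi : is_policy pi -> bandit_integral pi (cst 1) = 1.
Proof.
move=> [_ pi01]; transitivity (\int[nu]_x (cst 1) x); last first.
  by rewrite integral_cst// mul1e; exact: probability_setT.
apply: eq_integral => x _ /=.
transitivity (\sum_(a : action K) (pi x a)%:E); last first.
  by rewrite sumEFin (pi01 x).2.
by apply: eq_bigr => a _; rewrite integral_cst// mul1e prob_kernel mule1.
Qed.

(** Since [sample_law] is real-valued and [fine] sends infinite values to 0, the point is the
    finiteness of the kernel values and of the integral, both dominated by a total mass of 1. *)
Lemma sample_lawE pi B : is_policy pi ->
  measurable (B : set (X * action K * R)) ->
  (sample_law nu p pi B)%:E = bandit_integral pi (fun s => (\1_B s)%:E).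
Proof.
move=> pip mB; have [mpi pi01] := pip.
have pi0 x a : (0 <= pi x a)%R by have [+ _] := pi01 x; exact.
have mBxa xa : measurable [set c | B (xa, c)].
  by rewrite -[X in measurable X]setTI; exact: (pair1_measurable xa).
have pE x a : \int[p (x, a)]_c (\1_B (x, a, c))%:E = p (x, a) [set c | B (x, a, c)].
  by rewrite -[in RHS](setIT [set c | B (x, a, c)]) -integral_indic.
have pfin x a : p (x, a) [set c | B (x, a, c)] \is a fin_num.
  by rewrite ge0_fin_numE// (le_lt_trans _ (ltry 1))//
    -(@prob_kernel _ _ _ _ _ p (x, a)) le_measure// inE.
have intE : \int[nu]_x (\sum_(a : action K) pi x a *
     fine (p (x, a) [set c | B (x, a, c)]))%:E =
   bandit_integral pi (fun s => (\1_B s)%:E).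
  apply: eq_integral => x _; rewrite -sumEFin; apply: eq_bigr => a _.
  by rewrite EFinM fineK// pE.
rewrite /sample_law /Rintegral fineK intE//.
have [I0 _ _] := integral_like_bandit pip.
rewrite ge0_fin_numE; last exact/I0/nonneg_measurable_indic.
rewrite (le_lt_trans _ (ltry 1))// -(bandit_integral_cst1 pip).
have hB : nonneg_measurable (fun s => (\1_B s)%:E : \bar R).
  exact: nonneg_measurable_indic.
apply: le_bandit_integral => // s.
by rewrite lee_fin indicE; case: (_ \in _).
Qed.

End bandit_integral.

(** * Integration against a coarser sigma-algebra *)

Section sub_sigma_algebra.
Context {R : realType} {dO : measure_display} {Omega : measurableType dO}.
Local Open Scope ereal_scope.

Lemma measurable_to_g_sigma d (T : measurableType d) (G : set (set Omega))
    (f : T -> Omega) : (forall A, G A -> measurable (f @^-1` A)) ->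
  measurable_fun setT (f : T -> g_sigma_algebraType G).
Proof.
move=> hf; apply: (@measurability _ _ T (g_sigma_algebraType G) setT f G erefl) => // _ [A GA <-].
by rewrite setTI; exact: hf.
Qed.

(** Measurability for a sub-sigma-algebra is encoded as ordinary measurability on [Omega] retyped by
    [g_sigma_algebraType G]. Composition with this identity leads back to [Omega], where [Pr]
    lives. *)
Lemma measurable_id_g_sigma (G : set (set Omega)) : G `<=` measurable ->
  measurable_fun setT (id : Omega -> g_sigma_algebraType G).
Proof. by move=> Gm; apply: measurable_to_g_sigma => A /Gm. Qed.

Lemma measurable_of_g_sigma d (T : measurableType d) (G : set (set Omega))
    (f : Omega -> T) : (forall B, measurable B -> G (f @^-1` B)) ->
  measurable_fun setT (f : g_sigma_algebraType G -> T).
Proof.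
move=> hf _ B mB; rewrite setTI.
by apply: sub_sigma_algebra; exact: hf.
Qed.

Variables (Pr : probability Omega R) (G : set (set Omega)).
Hypotheses (Gm : G `<=` measurable) (GI : setI_closed G) (GT : G setT).

(** Both sides are [integral_like] in [f] on the coarser space, and the hypothesis on [g] is their
    equality at indicators of the pi-system [G]. It plays the role of taking a measurable factor out
    of a conditional expectation. *)
Lemma integral_density (E : set Omega) (g : Omega -> R) (f : Omega -> \bar R) :
  measurable E -> measurable_fun setT g -> (forall w, (0 <= g w)%R) ->
  (forall F, G F -> \int[Pr]_(w in F) (g w)%:E = Pr (F `&` E)) ->
  nonneg_measurable (f : g_sigma_algebraType G -> \bar R) ->
  \int[Pr]_(w in E) f w = \int[Pr]_w ((g w)%:E * f w).
Proof.
move=> mE mg g0 gE hf.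
have mid := measurable_id_g_sigma Gm.
pose T := g_sigma_algebraType G.
pose I (f : T -> \bar R) := \int[Pr]_(w in E) f w.
pose J (f : T -> \bar R) := \int[Pr]_w ((g w)%:E * f w).
have hI : integral_like I.
  apply: (@integral_like_integral _ _ _ _ _ Pr E (fun (w : Omega) (f : T -> \bar R) => f w))
    => // [w _|h [mh _]].
    exact: (@integral_like_eval R _ T w).
  apply: measurable_funTS; exact: (measurableT_comp mh mid).
have hJ : integral_like J.
  apply: (@integral_like_integral _ _ _ _ _ Pr setT (fun (w : Omega) (f : T -> \bar R)
    => (g w)%:E * f w)) => // [w _|h [mh _]].
    exact/(integral_like_scale (g0 w))/(@integral_like_eval R _ T w).
  apply: emeasurable_funM; first exact/measurable_EFinP.
  exact: (measurableT_comp mh mid).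
apply: (@integral_like_unique R _ T G I J) => //.
- by rewrite /I integral_cst// mul1e (le_lt_trans (probability_le1 _ _))// ltry.
- move=> A GA; transitivity (Pr (A `&` E)).
    by rewrite /I integral_indic//; exact: Gm.
  rewrite /J -gE// [LHS]integral_mkcond; apply: eq_integral => w _.
  by rewrite patchE indicE; case: (w \in A); rewrite ?mule1 ?mule0.
Qed.

End sub_sigma_algebra.

(** * Disintegration along a conditional law *)

Section disintegration.
Context {R : realType} {dX : measure_display} {X : measurableType dX} {K : nat}.
Variables (nu : probability X R) (p : R.-pker (X * action K) ~> R).
Context {dO : measure_display} {Omega : measurableType dO}.
Variables (Pr : probability Omega R) (G : set (set Omega)).
Hypotheses (Gm : G `<=` measurable) (GI : setI_closed G) (GT : G setT).
Local Open Scope ereal_scope.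
Local Notation T := (g_sigma_algebraType G).
Local Notation S := (X * action K * R)%type.
Variables (pi : Omega -> @policy R dX X K) (Z : Omega -> S).
Hypothesis mpi : forall a, measurable_fun setT (fun wx : T * X => pi wx.1 wx.2 a).
Hypothesis pip : forall w, is_policy (pi w).
Hypothesis mZ : measurable_fun setT Z.
Hypothesis Z_law : forall D B, G D -> measurable B ->
  \int[Pr]_(w in D) (sample_law nu p (pi w) B)%:E = Pr (D `&` Z @^-1` B).

Let pi0 w x a : (0 <= pi w x a)%R.
Proof. by have [_ /(_ x)[+ _]] := pip w; exact. Qed.

Lemma measurable_sample_law B : measurable B ->
  measurable_fun setT (fun w : T => sample_law nu p (pi w) B).
Proof.
move=> mB; apply/measurable_EFinP.
rewrite (_ : _ \o _ = (fun w : T => bandit_integral nu p (pi w) (fun s => (\1_B s)%:E))).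
  apply: (@measurable_bandit_integral _ _ _ _ nu p _ T pi (fun ws => (\1_B ws.2)%:E)) => //.
  exact: (nonneg_measurable_comp (@measurable_snd _ _ T S) (nonneg_measurable_indic mB)).
by apply/funext => w /=; rewrite sample_lawE.
Qed.

Lemma sample_law_ge0 w B : measurable B -> (0 <= sample_law nu p (pi w) B)%R.
Proof.
move=> mB; rewrite -lee_fin sample_lawE//.
have [+ _ _] := integral_like_bandit nu p (pip w).
by apply; exact: nonneg_measurable_indic.
Qed.

(** By uniqueness it suffices to treat rectangles, and [Z_law] is the case of a base in [G]. This is
    the usual rule for a conditional law: freeze the past [w], integrate the fresh sample. *)
Lemma disintegration (f : Omega * S -> \bar R) :
  nonneg_measurable (f : T * S -> \bar R) ->
  \int[Pr]_w f (w, Z w) = \int[Pr]_w bandit_integral nu p (pi w) (fun s => f (w, s)).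
Proof.
move=> hf; have mid := measurable_id_g_sigma Gm.
pose I (f : T * S -> \bar R) := \int[Pr]_w f (w, Z w).
pose J (f : T * S -> \bar R) :=
  \int[Pr]_w bandit_integral nu p (pi w) (fun s => f (w, s)).
have hI : integral_like I.
  apply: (@integral_like_integral _ _ _ _ _ Pr setT
    (fun (w : Omega) (f : T * S -> \bar R) => f (w, Z w))) => // [w _|h [mh _]].
    exact: (@integral_like_eval R _ (T * S)%type (w, Z w)).
  apply: (measurableT_comp mh); exact: measurable_fun_pair.
have hJ : integral_like J.
  apply: (@integral_like_integral _ _ _ _ _ Pr setT (fun (w : Omega)
    (f : T * S -> \bar R) => bandit_integral nu p (pi w) (fun s => f (w, s)))) => // [w _|h hh].
    apply: (@integral_like_comp _ _ _ S (T * S)%type (bandit_integral nu p (pi w)) (pair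
      (w : T))) => //.
    exact: integral_like_bandit.
  exact: (measurableT_comp (@measurable_bandit_integral _ _ _ _ nu p _ T pi h mpi pi0 hh) mid).
apply: (@integral_like_unique R _ (T * S)%type _ I J hI hJ
  (measurable_prod_measurableType _ _)) => //.
- move=> _ _ [A1 mA1 [B1 mB1 <-]] [A2 mA2 [B2 mB2 <-]].
  exists (A1 `&` A2); first exact: measurableI.
  by exists (B1 `&` B2); [exact: measurableI|rewrite setXI].
- by exists setT => //; exists setT => //; rewrite setXTT.
- rewrite /I (_ : \int[_]_ _ _ = \int[Pr]_w (cst 1 w))//.
  by rewrite integral_cst// mul1e (le_lt_trans (probability_le1 _ _))// ltry.
- move=> _ [A mA [B mB <-]].
  have mZB : measurable (Z @^-1` B) by rewrite -[X in measurable X]setTI; exact: mZ.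
  (* The base [A] belongs to the generated sigma-algebra and perhaps not to the pi-system [G], so
     [Z_law] enters as the density hypothesis, with the indicator of [A] as integrand. *)
  have := @integral_density R _ _ Pr G Gm GI GT (Z @^-1` B)
    (fun w => sample_law nu p (pi w) B) (fun w => (\1_A w)%:E) mZB
    (measurableT_comp (measurable_sample_law mB) mid) (fun w => sample_law_ge0 w mB)
    (fun F GF => Z_law GF mB) (nonneg_measurable_indic mA).
  rewrite /I /J => IJ; transitivity (\int[Pr]_(w in Z @^-1` B) (\1_A w)%:E).
    rewrite [RHS]integral_mkcond; apply: eq_integral => w _.
    have memZ : (w \in Z @^-1` B) = (Z w \in B) by apply/idP/idP; rewrite !inE.
    rewrite patchE !indicE in_setX/= memZ.
    by case: (_ \in A); case: (_ \in B).
  rewrite IJ; apply: eq_integral => w _.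
  rewrite sample_lawE//.
  have [_ BZ _] := integral_like_bandit nu p (pip w).
  rewrite muleC -BZ//; last exact: nonneg_measurable_indic.
  congr bandit_integral; apply/funext => s /=.
  by rewrite !indicE in_setX -EFinM; case: (_ \in A); case: (_ \in B); rewrite ?mul0r ?mul1r.
Qed.

End disintegration.

(** * One batch of conditionally independent samples *)

Section batch.
Context {R : realType} {dX : measure_display} {X : measurableType dX} {K m : nat}.
Variables (nu : probability X R) (p : R.-pker (X * action K) ~> R).
Context {dO : measure_display} {Omega : measurableType dO}.
Variables (Pr : probability Omega R) (G : set (set Omega)).
Hypotheses (Gm : G `<=` measurable) (Gs : sigma_algebra setT G).
Local Open Scope ereal_scope.
Local Notation H := (g_sigma_algebraType G).
Local Notation S := (X * action K * R)%type.
Variables (pi : Omega -> @policy R dX X K) (z : 'I_m -> Omega -> S).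
Hypothesis mpi : forall a, measurable_fun setT (fun wx : H * X => pi wx.1 wx.2 a).
Hypothesis pip : forall w, is_policy (pi w).
Hypothesis mz : forall i, measurable_fun setT (z i).
Hypothesis z_indep : cond_mutually_independent Pr G z.
Hypothesis z_law : forall i, has_cond_law Pr G (z i) (fun w => sample_law nu p (pi w)).
Local Notation q w B := (sample_law nu p (pi w) B).

(* A pi-system on Omega generating the sigma-algebra of G and of the first r
   samples. Revealing the samples of a batch one at a time in this way replaces
   an m-fold product kernel. *)
Let past_samples (r : nat) : set (set Omega) :=
  [set D | exists F, exists B : 'I_m -> set S, [/\ G F, forall i, measurable (B i),
    forall i : 'I_m, (r <= i)%N -> B i = setT & D = F `&` \bigcap_i (z i @^-1` B i)]].

Let GT : G setT.
Proof. by have [G0 GC _] := Gs; rewrite -(setD0 setT); exact: GC. Qed.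

Let GI : setI_closed G.
Proof.
move=> A B GA GB; rewrite -[G](sigma_algebra_id Gs).
by apply: (@measurableI _ H); exact: sub_sigma_algebra.
Qed.

Let mpre i B : measurable B -> measurable (z i @^-1` B).
Proof. by move=> mB; rewrite -[X in measurable X]setTI; exact: mz. Qed.

Let past_samplesm r : past_samples r `<=` measurable.
Proof.
move=> _ [F [B [GF mB _ ->]]]; apply: measurableI; first exact: Gm.
by apply: fin_bigcap_measurable => // i _; exact: mpre.
Qed.

Let past_samplesI r : setI_closed (past_samples r).
Proof.
move=> _ _ [F1 [B1 [GF1 mB1 B1T ->]]] [F2 [B2 [GF2 mB2 B2T ->]]].
exists (F1 `&` F2); exists (fun i => B1 i `&` B2 i); split.
- exact: GI.
- by move=> i; exact: measurableI.
- by move=> i ri; rewrite B1T// B2T// setIT.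
- by rewrite setIACA -bigcapI.
Qed.

Let past_samples_G r : G `<=` past_samples r.
Proof.
move=> F GF; exists F; exists (fun=> setT); split => //.
by rewrite (_ : \bigcap_i _ = setT) ?setIT//; apply/seteqP; split.
Qed.

Let past_samples_z r (i : 'I_m) B : (i < r)%N -> measurable B ->
  past_samples r (z i @^-1` B).
Proof.
move=> ir mB; exists setT; exists (fun j => if j == i then B else setT); split.
- exact: GT.
- by move=> j; case: ifP.
- by move=> j rj; case: eqP => // ji; move: rj; rewrite ji leqNgt ir.
- rewrite setTI; apply/seteqP; split=> [w Bw j _ /=|w /(_ i Logic.I)/=].
    by case: eqP => [->|].
  by rewrite eqxx.
Qed.

Let sample_law_setT w : q w setT = 1%R.
Proof.
apply: EFin_inj; rewrite sample_lawE// -(bandit_integral_cst1 nu p (pip w)).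
by congr bandit_integral; apply/funext => s; rewrite indicT.
Qed.

(** Conditional independence is used twice, for the family [C] defining [D] and for the family [C']
    that adds [B] at [r]. The two products of conditional probabilities differ by the factor
    [q w B], which depends on the past alone; so revealing earlier samples of the batch does not
    change the law of [z r]. *)
Let law_given_past_samples (r : 'I_m) D B : past_samples r D -> measurable B ->
  \int[Pr]_(w in D) (q w B)%:E = Pr (D `&` z r @^-1` B).
Proof.
move=> [F [C [GF mC CT ->]]] mB.
(* As [C r = setT], the event [D] puts no condition on [z r], and this slot is free to receive
   [B]. *)
pose C' i := if i == r then B else C i.
have mC' i : measurable (C' i) by rewrite /C'; case: ifP.
pose E := \bigcap_i (z i @^-1` C i).
have mE : measurable E by apply: fin_bigcap_measurable => // i _; exact: mpre.
have [_ _ C'E] := z_indep mC' (fun i => z_law i (mC' i)).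
have [_ _ CE] := z_indep mC (fun i => z_law i (mC i)).
have CC' : \bigcap_i (z i @^-1` C' i) = E `&` z r @^-1` B.
  apply/seteqP; split=> [w C'w|w [Cw Bw] i _ /=]; last first.
    by rewrite /C'; case: eqP => [->//|_]; exact: Cw.
  split=> [i _ /=|]; last by have := C'w r Logic.I; rewrite /C' /= eqxx.
  have [->|ir] := eqVneq i r; first by rewrite CT.
  by have := C'w i Logic.I; rewrite /C' /= (negbTE ir).
rewrite -/E -setIA -CC' -C'E//.
have mid := measurable_id_g_sigma Gm.
have mq A : measurable A -> measurable_fun setT (fun w : H => q w A).
  by move=> mA; exact: measurable_sample_law.
have q0 w A : measurable A -> (0 <= q w A)%R.
  by move=> mA; exact: sample_law_ge0.
pose f w := (q w B * \1_F w)%:E.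
transitivity (\int[Pr]_(w in E) f w).
  rewrite integral_mkcond [RHS]integral_mkcond; apply: eq_integral => w _.
  rewrite !patchE in_setI /f indicE.
  by case: (w \in F); case: (w \in E); rewrite //= ?mulr1 ?mulr0.
(* The product of the [q w (C i)] is the density of [E] given [G]; its factor at [r] is 1, and [f]
   supplies [q w B] in its place. *)
rewrite (@integral_density R _ _ Pr G Gm GI GT E (fun w => \prod_i q w (C i))%R).
- rewrite [RHS]integral_mkcond; apply: eq_integral => w _.
  rewrite patchE /f -EFinM (bigD1 r)//= [in RHS](bigD1 r)//= CT// sample_law_setT mul1r.
  have -> : (\prod_(i < m | i != r) q w (C' i) = \prod_(i < m | i != r) q w (C i))%R.
    by apply: eq_bigr => i ir; rewrite /C' (negbTE ir).
  by rewrite /C' eqxx indicE; case: (_ \in _); rewrite ?mulr1 ?mulr0// mulrC.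
- by [].
- apply: measurable_prod => i _; exact: (measurableT_comp (mq _ (mC i)) mid).
- by move=> w; apply: prodr_ge0 => i _; exact: q0.
- exact: CE.
- split.
  + apply/measurable_EFinP; apply: measurable_funM; first exact: mq.
    by apply: measurable_indic; exact: sub_sigma_algebra.
  + by move=> w; rewrite lee_fin mulr_ge0// q0.
Qed.


Variables (M : Omega -> R) (Phi : Omega * S -> R).
Hypotheses (mM : measurable_fun setT (M : H -> R)) (M0 : forall w, (0 <= M w)%R).
Hypotheses (mPhi : measurable_fun setT (Phi : H * S -> R)).
Hypothesis Phi0 : forall ws, (0 <= Phi ws)%R.
Hypothesis Phi1 : forall w, bandit_integral nu p (pi w) (fun s => (Phi (w, s))%:E) <= 1.

(** All [m] indices are kept and those from [r] on are masked by 1, so that consecutive values of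
    [r] differ in a single factor. *)
Let partial r w := (M w * \prod_(i < m) if (i < r)%N then Phi (w, z i w) else 1)%R.

Let partial0 r w : (0 <= partial r w)%R.
Proof. by rewrite mulr_ge0//; apply: prodr_ge0 => i _; case: ifP. Qed.

Let measurable_partial r :
  measurable_fun setT (partial r : g_sigma_algebraType (past_samples r) -> R).
Proof.
have mid : measurable_fun setT (id : g_sigma_algebraType (past_samples r) -> H).
  apply: measurable_to_g_sigma => A GA.
  by apply: sub_sigma_algebra; exact: past_samples_G.
apply: measurable_funM; first exact: (measurableT_comp mM mid).
apply: measurable_prod => i _; case: (ltnP i r) => // ir.
apply: (measurableT_comp mPhi); apply: measurable_fun_pair => //.
by apply: measurable_of_g_sigma => B mB; exact: past_samples_z.
Qed.

(** The only fresh quantity is the argument [z r] of the last factor. Disintegration along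
    [past_samples r] integrates it out, [partial r] comes out by homogeneity, and the remaining mean
    is at most 1 by [Phi1]. *)
Let partial_step (r : 'I_m) :
  \int[Pr]_w (partial r.+1 w)%:E <= \int[Pr]_w (partial r w)%:E.
Proof.
pose Psi (ws : (g_sigma_algebraType (past_samples r)) * S) := (partial r ws.1 * Phi ws)%:E.
have mid : measurable_fun setT (id : (g_sigma_algebraType (past_samples r)) -> H).
  apply: measurable_to_g_sigma => A GA.
  by apply: sub_sigma_algebra; exact: past_samples_G.
have mmid : measurable_fun setT (id : (g_sigma_algebraType (past_samples r)) * S -> H * S).
  apply/measurable_fun_pairP; split; last exact: measurable_snd.
  exact: (measurableT_comp mid measurable_fst).
have hPsi : nonneg_measurable Psi.
  split; last by move=> ws; rewrite lee_fin mulr_ge0.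
  apply/measurable_EFinP; apply: measurable_funM.
    exact: (measurableT_comp (@measurable_partial r) measurable_fst).
  exact: (measurableT_comp mPhi mmid).
have midX : measurable_fun setT (id : (g_sigma_algebraType (past_samples r)) * X -> H * X).
  apply/measurable_fun_pairP; split; last exact: measurable_snd.
  exact: (measurableT_comp mid measurable_fst).
have -> : \int[Pr]_w (partial r.+1 w)%:E = \int[Pr]_w Psi (w, z r w).
  apply: eq_integral => w _; congr (_%:E).
  rewrite /partial -mulrA; congr (_ * _)%R.
  rewrite (bigD1 r)//= ltnSn [in RHS](bigD1 r)//= ltnn mul1r mulrC; congr (_ * _)%R.
  apply: eq_bigr => i ir; rewrite ltnS leq_eqVlt.
  by rewrite (_ : (i == r :> nat) = false)//; exact/negbTE.
rewrite (@disintegration _ _ _ _ nu p _ _ Pr (past_samples r) _ _ _ pi (z r))//.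
- have hPsi_ w : nonneg_measurable (fun s : S => Psi (w, s)).
    exact: (nonneg_measurable_comp (pair1_measurable (w : (g_sigma_algebraType
      (past_samples r)))) hPsi).
  have hPhi_ w : nonneg_measurable (fun s : S => (Phi (w, s))%:E).
    split; last by move=> s; rewrite lee_fin.
    by apply/measurable_EFinP; exact: (measurableT_comp mPhi (pair1_measurable (w : H))).
  have midT := measurable_id_g_sigma (@past_samplesm r).
  have pi0 w x a : (0 <= pi w x a)%R by have [_ /(_ x)[+ _]] := pip w; exact.
  apply: ge0_le_integral => //.
  + move=> w _; have [B0 _ _] := integral_like_bandit nu p (pip w).
    by apply: B0; exact: hPsi_.
  + have mpiT a : measurable_fun setT
        (fun wx : g_sigma_algebraType (past_samples r) * X => pi wx.1 wx.2 a).
      exact: (measurableT_comp (mpi a) midX).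
    have mb := @measurable_bandit_integral _ _ _ _ nu p _ (g_sigma_algebraType
      (past_samples r)) pi Psi mpiT pi0 hPsi.
    by have := measurableT_comp mb midT; exact.
  + apply/measurable_EFinP; exact: (measurableT_comp (@measurable_partial r) midT).
  + move=> w _; have [_ BZ _] := integral_like_bandit nu p (pip w).
    rewrite (_ : bandit_integral _ _ _ _ = (partial r w)%:E *
        bandit_integral nu p (pi w) (fun s => (Phi (w, s))%:E)).
      by rewrite -[leRHS]mule1 lee_wpmul2l// lee_fin.
    by rewrite -BZ.
- exact/past_samples_G/GT.
- move=> a; exact: (measurableT_comp (mpi a) midX).
- by move=> D B hD mB; exact: law_given_past_samples.
Qed.

Lemma batch_supermartingale :
  \int[Pr]_w (M w * \prod_(i < m) Phi (w, z i w))%:E <= \int[Pr]_w (M w)%:E.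
Proof.
have H r : (r <= m)%N -> \int[Pr]_w (partial r w)%:E <= \int[Pr]_w (M w)%:E.
  elim: r => [_|r IH rm].
    rewrite le_eqVlt; apply/orP; left; apply/eqP; apply: eq_integral => w _.
    by rewrite /partial big1 ?mulr1.
  by apply: (le_trans (@partial_step (Ordinal rm))); exact/IH/ltnW.
rewrite (le_trans _ (H m (leqnn m)))// le_eqVlt; apply/orP; left; apply/eqP.
by apply: eq_integral => w _; rewrite /partial; congr (_ * _)%:E; apply: eq_bigr => i _;
  rewrite ltn_ord.
Qed.

End batch.

(** * Inversion, and integrals of bounded functions under a probability *)

Lemma measurable_inv (R : realType) : measurable_fun setT (@GRing.inv R).
Proof.
have -> : [set: R] = [set 0] `|` [set r | r != 0].
  by apply/seteqP; split=> // r _; have [->|r0] := eqVneq r 0; [left|right].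
apply/measurable_funU => //; first exact: open_measurable.
split; first exact: measurable_fun_set1.
apply: open_continuous_measurable_fun => //; apply/in_setP => x /= x0.
exact: inv_continuous.
Qed.

Section probability_integrals.
Context {R : realType} {d : measure_display} {T : measurableType d}.
Variable mu : {measure set T -> \bar R}.
Hypothesis mu1 : mu setT = 1%E.

Lemma bounded_integrable (f : T -> R) (C : R) :
  measurable_fun setT f -> (forall x, `|f x| <= C) -> mu.-integrable setT (EFin \o f).
Proof.
move=> mf fC; apply: measurable_bounded_integrable => //.
  by rewrite mu1 ltry.
by exists C; split; rewrite ?num_real// => M CM x _ /=; rewrite (le_trans (fC x))// ltW.
Qed.

Lemma EFin_Rintegral (f : T -> R) : mu.-integrable setT (EFin \o f) ->
  (\int[mu]_x f x)%:E = (\int[mu]_x (f x)%:E)%E.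
Proof. by move=> fi; rewrite /Rintegral fineK//; exact: integrable_fin_num. Qed.

Lemma Rintegral_prob_cst (c : R) : \int[mu]_x c = c.
Proof.
by rewrite (_ : (fun=> c) = cst c)// Rintegral_cst//= mu1 mulr1.
Qed.

Lemma Rintegral_affine (f : T -> R) (a b : R) : mu.-integrable setT (EFin \o f) ->
  \int[mu]_x (a + b * f x) = a + b * \int[mu]_x f x.
Proof.
move=> fi; have ci : mu.-integrable setT (EFin \o (fun=> a)).
  by apply: (bounded_integrable (C := `|a|)) => //.
have bfi : mu.-integrable setT (EFin \o (fun x => b * f x)).
  rewrite (_ : _ \o _ = (fun x => b%:E * (EFin \o f) x)%E); last by apply/funext.
  exact: integrableZl.
by rewrite RintegralD// RintegralZl// Rintegral_prob_cst.
Qed.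

Lemma Rintegral_itv (f : T -> R) (a b : R) : measurable_fun setT f ->
  (forall x, a <= f x <= b) -> a <= \int[mu]_x f x <= b.
Proof.
move=> mf fab.
have fi : mu.-integrable setT (EFin \o f).
  apply: (bounded_integrable (C := `|a| + `|b|)) => // x.
  have /andP[af fb] := fab x; rewrite ler_norml; apply/andP; split.
    by rewrite (le_trans _ af)// lerNl; have := ler_norm (- a); rewrite normrN;
      have := normr_ge0 b; lra.
  by rewrite (le_trans fb)//; have := ler_norm b; have := normr_ge0 a; lra.
have ci (c : R) : mu.-integrable setT (EFin \o (fun=> c)).
  by apply: (bounded_integrable (C := `|c|)) => //.
have := @le_Rintegral _ _ _ mu setT (fun=> a) f measurableT (ci a) fi.
have := @le_Rintegral _ _ _ mu setT f (fun=> b) measurableT fi (ci b).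
rewrite !Rintegral_prob_cst => fb af.
by rewrite af ?fb// => x _; have /andP[] := fab x.
Qed.

End probability_integrals.

(** * Costs and the importance-weighted exponential *)

Section costs.
Context {R : realType} {dX : measure_display} {X : measurableType dX} {K : nat}.
Variables (nu : probability X R) (p : R.-pker (X * action K) ~> R).
Hypothesis p_cost : forall x a, p (x, a) [set c : R | -1 <= c <= 0] = 1%E.
Local Notation cost := (mean_cost p).

Let p1 xa : p xa setT = 1%E.
Proof. exact: prob_kernel. Qed.

(** Costs lie in [-1, 0] only almost surely, and [c] is unbounded on the line. [clip] agrees with
    [- c] on that interval and stays in [0, 1] everywhere, which makes integrability and
    measurability in the kernel parameter immediate. *)
Let clip (c : R) := Num.min 1 (Num.max (- c) 0).

Let clipE c : -1 <= c <= 0 -> clip c = - c.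
Proof.
by move=> /andP[c1 c0]; rewrite /clip (max_idPl _) ?(min_idPr _)//; lra.
Qed.

Let clip01 c : 0 <= clip c <= 1.
Proof.
by rewrite /clip ge_min lexx/= le_min ler01/= le_max lexx orbT.
Qed.

Let mclip : measurable_fun setT clip.
Proof.
apply: measurable_minr => //; apply: measurable_maxr => //.
Qed.

Let mcost : measurable [set c : R | -1 <= c <= 0].
Proof. by rewrite -set_itvcc; exact: measurable_itv. Qed.

Let ae_cost xa (P : R -> Prop) : (forall c, -1 <= c <= 0 -> P c) ->
  {ae p xa, forall c, setT c -> P c}.
Proof.
case: xa => x a hP; exists (~` [set c : R | -1 <= c <= 0]); split.
- exact: measurableC.
- have k1 : p (x, a) setT = 1%E by exact: p1.
  rewrite -setTD measureD ?setTI//; last by rewrite [ltLHS]k1 ltry.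
  transitivity (1 - 1 : \bar R)%E; last by rewrite subee.
  by congr (_ - _)%E; [exact: k1|exact: p_cost].
- move=> c /= nP cc; apply: nP => _; exact: hP.
Qed.

Let clip_int xa : (p xa).-integrable setT (EFin \o clip).
Proof.
apply: (bounded_integrable (C := 1) (p1 xa)) => // c.
by have /andP[c0 c1] := clip01 c; rewrite ger0_norm.
Qed.

Let costE a x : cost a x = - \int[p (x, a)]_c clip c.
Proof.
rewrite /mean_cost -[RHS]mulN1r -RintegralZl//.
rewrite /Rintegral; congr fine; apply: ae_eq_integral => //.
- by apply/measurable_EFinP/measurable_funM.
- by apply: ae_cost => c /clipE ->; rewrite mulN1r opprK.
Qed.

Lemma mean_cost_itv a x : -1 <= cost a x <= 0.
Proof.
rewrite costE; have /andP[h0 h1] := Rintegral_itv (p1 (x, a)) mclip clip01.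
by apply/andP; split; lra.
Qed.

Lemma measurable_mean_cost :
  measurable_fun setT (fun xa : X * action K => cost xa.2 xa.1).
Proof.
rewrite (_ : (fun _ => _) = (fun xa => - fine (\int[p xa]_c (clip c)%:E)%E)).
  apply: measurableT_comp => //; apply: measurableT_comp => //.
  apply: (@measurable_fun_integral_kernel _ _ _ _ _ p).
  - exact: measurable_kernel.
  - by move=> c; rewrite lee_fin; have /andP[] := clip01 c.
  - exact/measurable_EFinP.
by apply/funext => -[x a] /=; rewrite costE.
Qed.

(** For [c <= 0] the argument of [ln] is at least 1, so [expR] cancels [ln] and the integrand is
    affine in [c]. Elsewhere this can fail, [ln] having a default value on nonpositive reals; hence
    the almost everywhere comparison. *)
Lemma integral_exp_weight (x : X) (a : action K) (k l : R) : 0 <= k ->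
  (\int[p (x, a)]_c (expR (l + ln (1 - k * c)))%:E = (expR l * (1 - k * cost a x))%:E)%E.
Proof.
move=> k0; transitivity (\int[p (x, a)]_c (expR l + expR l * k * clip c)%:E)%E.
  apply: ae_eq_integral => //.
  - apply/measurable_EFinP; apply: measurableT_comp => //.
    apply: measurable_funD => //; apply: measurableT_comp => //.
    by apply: measurable_funB => //; apply: measurable_funM.
  - by apply/measurable_EFinP; apply: measurable_funD => //; apply: measurable_funM.
  - apply: ae_cost => c c01; rewrite clipE// expRD lnK; last first.
      by rewrite posrE; have /andP[c1 c0] := c01; nra.
    by congr (_%:E); ring.
have hi : (p (x, a)).-integrable setT (EFin \o (fun c => expR l + expR l * k * clip c)).
  apply: (bounded_integrable (C := expR l + expR l * k) (p1 (x, a))).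
    by apply: measurable_funD => //; apply: measurable_funM.
  move=> c; have /andP[c0 c1] := clip01 c; have e0 := expR_gt0 l.
  rewrite ger0_norm; last by rewrite addr_ge0 ?mulr_ge0 ?(ltW e0).
  by rewrite lerD2l ler_piMr// mulr_ge0// ltW.
rewrite -EFin_Rintegral// (Rintegral_affine (p1 (x, a)))// costE.
by congr (_%:E); ring.
Qed.

Definition predictor_risk (h : X -> action K) : R := \int[nu]_x cost (h x) x.

(* 1 - k c has mean 1 - k cost, and e^(lambda r) (1 - lambda r) <= 1. Where pi
   vanishes, the convention x / 0 = 0 makes the logarithm vanish, which drops a
   nonnegative term. *)
Lemma bandit_integral_exp_weight (pi : policy X K) (h : X -> action K) (lambda : R) :
  is_policy pi -> measurable_fun setT h -> 0 <= lambda ->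
  (bandit_integral nu p pi (fun s => (expR (lambda * predictor_risk h +
     (h s.1.1 == s.1.2)%:R * ln (1 - lambda * s.2 / pi s.1.1 s.1.2)))%:E) <= 1)%E.
Proof.
move=> pip mh l0; have [mpi pi01] := pip.
have pi0 x a : 0 <= pi x a by have [+ _] := pi01 x; exact.
have nu1 : nu setT = 1%E by exact: probability_setT.
set r := predictor_risk h; pose e := expR (lambda * r).
(* The indicator moves inside the logarithm: for [b] equal to 0 or 1,
   [b * ln (1 - u) = ln (1 - b * u)], because [ln 1 = 0]. *)
pose k x a := (h x == a)%:R * (lambda / pi x a).
have k0 x a : 0 <= k x a by rewrite /k mulr_ge0// divr_ge0.
have costh_itv x : -1 <= cost (h x) x <= 0 by exact: mean_cost_itv.
have mcosth : measurable_fun setT (fun x => cost (h x) x).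
  have mxh : measurable_fun setT (fun x => (x, h x)) by exact: measurable_fun_pair.
  exact: (measurableT_comp measurable_mean_cost mxh).
have costh_int : nu.-integrable setT (EFin \o (fun x => cost (h x) x)).
  apply: (bounded_integrable (C := 1) nu1) => // x.
  by have /andP[h0 h1] := costh_itv x; rewrite ler_norml; apply/andP; split; lra.
have e0 : 0 < e by exact: expR_gt0.
have inner x a : (\int[p (x, a)]_c (expR (lambda * r +
    (h x == a)%:R * ln (1 - lambda * c / pi x a)))%:E =
    (e * (1 - k x a * cost a x))%:E)%E.
  rewrite -integral_exp_weight//; apply: eq_integral => c _; congr (expR (_ + _))%:E.
  rewrite /k; case: eqP => _; last by rewrite !mul0r subr0 ln1.
  by rewrite !mul1r mulrAC.
apply: (@le_trans _ _ (\int[nu]_x (e + (- e * lambda) * cost (h x) x)%:E)%E).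
  apply: ge0_le_integral => //.
  - move=> x _; apply: sume_ge0 => a _; rewrite mule_ge0 ?lee_fin//.
    by apply: integral_ge0 => c _; rewrite lee_fin expR_ge0.
  - under eq_fun do under eq_bigr do rewrite inner.
    apply: emeasurable_sum => a; apply: emeasurable_funM; first exact/measurable_EFinP.
    apply/measurable_EFinP; apply: measurable_funM => //; apply: measurable_funB => //.
    have mha : measurable_fun setT (fun x : X => (h x == a)%:R : R).
      by apply: (@measurableT_comp _ _ _ X (action K) R (fun b => (b == a)%:R) setT h) => // _ Y _.
    apply: measurable_funM; first by apply: measurable_funM => //;
      apply: measurable_funM => //; exact: (measurableT_comp (@measurable_inv R) (mpi a)).
    have mxa : measurable_fun setT (fun x : X => (x, a)) by exact: measurable_fun_pair.
    exact: (measurableT_comp measurable_mean_cost mxa).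
  - by apply/measurable_EFinP; apply: measurable_funD => //; apply: measurable_funM.
  - move=> x _; under eq_bigr do rewrite inner -EFinM.
    rewrite sumEFin lee_fin.
    (* The probabilities [pi x a] sum to 1, which isolates [e]; in the other sum only the action
       [h x] survives, where a nonzero [pi] cancels its inverse. *)
    rewrite (_ : \sum_(a : action K) _ = e + e * \sum_(a : action K) - (pi x a * k x a * cost a x)).
      rewrite lerD2l mulNr -mulrN -mulrA ler_pM2l//.
      rewrite (bigD1 (h x))//= big1 ?addr0; last first.
        by move=> a /negbTE ha; rewrite /k eq_sym ha mul0r mulr0 mul0r oppr0.
      rewrite /k eqxx mul1r.
      have [->|pih] := eqVneq (pi x (h x)) 0.
        by rewrite !mul0r oppr0 mulNr oppr_ge0; have /andP[h0 h1] := costh_itv x; nra.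
      by rewrite mulrCA divff// mulr1 mulNr.
    transitivity (\sum_(a : action K) (e * pi x a + e * - (pi x a * k x a * cost a x))).
      by apply: eq_bigr => a _; ring.
    by rewrite big_split/= -!mulr_sumr (pi01 x).2 mulr1.
rewrite -EFin_Rintegral; last first.
  apply: (bounded_integrable (C := e + e * lambda) nu1).
    by apply: measurable_funD => //; apply: measurable_funM.
    move=> x; have /andP[h0 h1] := costh_itv x; have el := mulr_ge0 (ltW e0) l0.
  by rewrite ler_norml; apply/andP; split; nra.
rewrite (Rintegral_affine nu1)// -/(predictor_risk h) -/r lee_fin.
have := expR_ge1Dx (- (lambda * r)); rewrite expRN -/e => h1.
rewrite (_ : _ + _ = e * (1 - lambda * r)); last by ring.
apply: (@le_trans _ _ (e * e^-1)); first by rewrite ler_pM2l.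
by rewrite mulfV// gt_eqF.
Qed.

End costs.

(** * The filtration generated by the batches *)

Section past.
Context {R : realType} {dX : measure_display} {X : measurableType dX} {K m : nat}.
Context {dO : measure_display} {Omega : measurableType dO}.
Variables (z : nat -> 'I_m -> Omega -> sample (R := R) X K).
Variables (pi0 : policy (R := R) X K) (alg : algorithm (R := R) X K m).
Hypothesis mz : forall k i, measurable_fun setT (z k i).
Hypothesis pi0_policy : is_policy pi0.
Hypothesis alg_algorithm : is_algorithm alg.

Lemma measurable_history d (T : measurableType d) (g : T -> Omega) k :
  (forall j i, (j <= k)%N -> measurable_fun setT (z j i \o g)) ->
  measurable_fun setT (history z k \o g).
Proof.
move=> mzg; apply/measurable_fun_tnthP => j.
rewrite (_ : _ \o _ = batch_at z j \o g); last first.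
  by apply/funext => w /=; rewrite tnth_mktuple.
apply/measurable_fun_tnthP => i.
rewrite (_ : _ \o _ = z j i \o g); last by apply/funext => w /=; rewrite tnth_mktuple.
by apply: mzg; rewrite -ltnS.
Qed.

Lemma past_sigma_algebra k : sigma_algebra setT (past z k).
Proof.
case: k => [|k] /=; last first.
  exact: sigma_algebra_preimage (@sigma_algebra_measurable _ _).
split; first by left.
- by move=> A [->|->]; [right; rewrite setD0|left; rewrite setDv].
- move=> F F01; have [[i Fi]|F0] := pselect (exists i, F i = setT).
    by right; apply/seteqP; split=> // w _; exists i; rewrite ?Fi.
  left; rewrite bigcup0// => i _; case: (F01 i) => // Fi.
  by case: F0; exists i.
Qed.

Lemma past_measurable k : past z k `<=` measurable.
Proof.
case: k => [|k] /= A; first by case=> ->.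
by case=> B mB <-; apply: (@measurable_history _ Omega id) => // j i _; exact: mz.
Qed.

(** The index shift matters: [past z k] is what is known before batch [k] is drawn. It determines
    [policy_at k], while batch [k] itself is measurable from [past z k.+1] on. *)
Lemma history_past k : measurable_fun setT
  (history z k : g_sigma_algebraType (past z k.+1) -> k.+1.-tuple (batch X K m)).
Proof.
apply: measurable_of_g_sigma => B mB.
by exists B => //; rewrite setTI.
Qed.

Lemma sample_past k i : measurable_fun setT
  (z k i : g_sigma_algebraType (past z k.+1) -> X * action K * R).
Proof.
have /measurable_fun_tnthP/(_ ord_max)/measurable_fun_tnthP/(_ i) := @history_past k.
rewrite (_ : _ \o _ = z k i)//.
by apply/funext => w /=; rewrite !tnth_mktuple.
Qed.

Lemma past_succ k : past z k `<=` past z k.+1.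
Proof.
have [s0 sC _] := past_sigma_algebra k.+1.
case: k s0 sC => [|k] s0 sC A.
  by case=> ->; [exact: s0|rewrite -(setD0 setT); exact: sC].
move=> [B mB <-] /=.
pose proj (t : k.+2.-tuple (batch (R := R) X K m)) : k.+1.-tuple (batch X K m) :=
  [tuple tnth t (widen_ord (leqnSn _) i) | i < k.+1].
have mproj : measurable_fun setT proj.
  apply/measurable_fun_tnthP => i.
  rewrite (_ : _ \o _ = (fun t => tnth t (widen_ord (leqnSn _) i))).
    by have /measurable_fun_tnthP := @measurable_id _ (k.+2.-tuple (batch
      (R := R) X K m)) setT; exact.
  by apply/funext => t /=; rewrite tnth_mktuple.
exists (proj @^-1` B).
  by rewrite -[X in measurable X]setTI; exact: mproj.
rewrite !setTI -comp_preimage; congr (_ @^-1` B).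
apply/funext => w; apply: eq_from_tnth => i /=.
by rewrite !tnth_mktuple.
Qed.

Lemma measurable_id_past k : measurable_fun setT
  (id : g_sigma_algebraType (past z k.+1) -> g_sigma_algebraType (past z k)).
Proof.
by apply: measurable_to_g_sigma => A /past_succ; exact: sub_sigma_algebra.
Qed.

Lemma policy_at_policy k w : is_policy (policy_at z pi0 alg k w).
Proof. by case: k => [|k] //=; exact: alg_algorithm.1. Qed.

Lemma measurable_policy_at k a : measurable_fun setT
  (fun wx : g_sigma_algebraType (past z k) * X => policy_at z pi0 alg k wx.1 wx.2 a).
Proof.
case: k => [|k] /=.
  exact: (measurableT_comp (pi0_policy.1 a) measurable_snd).
have mh : measurable_fun setT (fun wx : g_sigma_algebraType (past z k.+1) * X =>
    (history z k wx.1, wx.2)).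
  apply: measurable_fun_pair => //.
  exact: (measurableT_comp (@history_past k) measurable_fst).
exact: (measurableT_comp (alg_algorithm.2 k a) mh).
Qed.

End past.

(** * Change of measure and relative entropy *)

Section change_of_measure.
Context {R : realType} {d : measure_display} {T : measurableType d}.
Local Open Scope ereal_scope.
Local Open Scope charge_scope.

(** Positive and negative parts are compared separately, so that infinite values and infinite
    integrals are allowed, as the logarithm of a density requires. *)
Lemma ae_le_integral (mu : {measure set T -> \bar R}) (f g : T -> \bar R) :
  measurable_fun setT f -> measurable_fun setT g ->
  {ae mu, forall x, f x <= g x} -> \int[mu]_x f x <= \int[mu]_x g x.
Proof.
move=> mf mg fg; rewrite integralE [leRHS]integralE; apply: leeB.
- apply: ae_ge0_le_integral => //.
  + exact: measurable_funepos.
  + exact: measurable_funepos.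
  + apply: filterS fg => x fgx _.
    by rewrite !funeposE ge_max !le_max fgx lexx !orbT.
- apply: ae_ge0_le_integral => //.
  + exact: measurable_funeneg.
  + exact: measurable_funeneg.
  + apply: filterS fg => x fgx _.
    by rewrite !funenegE ge_max !le_max leeN2 fgx lexx !orbT.
Qed.

Variables (Q P : probability T R).
Local Notation dQdP := ('d (charge_of_finite_measure Q) '/d P).

Hypothesis QP : Q `<< P.

(** This version of the density is nonnegative at every point and comes with a change of variables
    formula; the derivative in [KL] equals it almost everywhere. *)
Let RN := Radon_Nikodym_SigmaFinite.f Q P.

Let ae_RN : {ae Q, forall t, dQdP t = RN t}.
Proof.
have h := @ae_eq_Radon_Nikodym_SigmaFinite _ _ _ Q P QP setT measurableT.
have := null_dominates_ae_eq measurableT QP h.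
by apply: filterS => t /(_ Logic.I)/esym.
Qed.

Let mRN : measurable_fun setT RN.
Proof. exact: measurable_int (Radon_Nikodym_SigmaFinite.f_integrable QP). Qed.

Let RN_ge0 t : 0 <= RN t.
Proof. exact: Radon_Nikodym_SigmaFinite.f_ge0. Qed.

Let RN_fin t : RN t \is a fin_num.
Proof. exact: Radon_Nikodym_SigmaFinite.f_fin_num. Qed.

(** The mass that [Q] gives to the zero set of its density is the integral of 0. Under [P] this set
    may be large, so logarithms are compared [Q]-almost everywhere. *)
Let ae_RN_gt0 : {ae Q, forall t, 0 < RN t}.
Proof.
exists [set t | RN t = 0]; split.
- by rewrite -[X in measurable X]setTI; exact: (mRN measurableT (emeasurable_set1 0)).
- rewrite (Radon_Nikodym_SigmaFinite.f_integral QP); last first.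
    by rewrite -[X in measurable X]setTI; exact: (mRN measurableT (emeasurable_set1 0)).
  by apply: integral0_eq => t.
- by move=> t /= /negP; rewrite -leNgt => h; apply/eqP; rewrite eq_le h RN_ge0.
Qed.

(* Pointwise, ln x <= x - 1 is applied to x = e^L / (C dQ/dP), whose Q-integral is
   at most 1. *)
Lemma donsker_varadhan (L : T -> R) (C : R) :
  measurable_fun setT L -> Q.-integrable setT (EFin \o L) -> (0 < C)%R ->
  \int[P]_t (expR (L t))%:E <= C%:E ->
  \int[Q]_t (L t)%:E <= \int[Q]_t lne (dQdP t) + (ln C)%:E.
Proof.
move=> mL iL C0 LC.
pose u t := (expR (L t) / C * (fine (RN t))^-1)%R.
have mu_ : measurable_fun setT u.
  apply: measurable_funM; first by apply: measurable_funM => //; exact: measurableT_comp.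
  apply: (measurableT_comp (@measurable_inv R)); exact: measurableT_comp.
have u0 t : (0 <= u t)%R.
  by rewrite mulr_ge0// ?invr_ge0 ?fine_ge0// divr_ge0// ?expR_ge0// ltW.
have u1 : \int[Q]_t (u t)%:E <= 1.
  rewrite -(Radon_Nikodym_SigmaFinite.change_of_variables QP)//; last exact/measurable_EFinP.
  (* Only an inequality: where the density vanishes, [u] is 0 by the convention on inverses, and the
     part of [P] not charged by [Q] is lost. *)
  apply: (@le_trans _ _ (\int[P]_t (C^-1%:E * (expR (L t))%:E))).
    apply: ge0_le_integral => //.
    - by move=> t _; rewrite mule_ge0// lee_fin.
    - by apply: emeasurable_funM => //; exact/measurable_EFinP.
    - apply: emeasurable_funM => //; apply/measurable_EFinP; exact: measurableT_comp.
    - move=> t _; rewrite -/RN -(fineK (RN_fin t)) -!EFinM lee_fin /u.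
      have [->|RN0] := eqVneq (fine (RN t)) 0%R.
        by rewrite mulr0 mulr_ge0 ?invr_ge0 ?(ltW C0)// expR_ge0.
      by rewrite divfK// mulrC.
  rewrite ge0_integralZl//; last 2 first.
  - by apply/measurable_EFinP; exact: measurableT_comp.
  - by rewrite lee_fin invr_ge0 ltW.
  by rewrite lee_pdivrMl// mule1.
have iu : Q.-integrable setT (EFin \o u).
  apply/integrableP; split; first exact/measurable_EFinP.
  under eq_integral do rewrite /= ger0_norm//.
  exact: (le_lt_trans u1 (ltry _)).
have iLu : Q.-integrable setT (EFin \o (fun t => L t - u t)%R).
  rewrite (_ : _ \o _ = (EFin \o L) \- (EFin \o u)); last by apply/funext.
  exact: integrableB.
have mdQdP : measurable_fun setT dQdP by exact: measurable_int (Radon_Nikodym_integrable _).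
(* The entropy integral may be [+oo], so it stays alone on one side; the other side is integrable
   and affine in [L - u]. *)
have key : \int[Q]_t ((1 - ln C) + 1 * (L t - u t))%:E <= \int[Q]_t lne (dQdP t).
  apply: ae_le_integral.
  - apply/measurable_EFinP; apply: measurable_funD => //; apply: measurable_funM => //.
    exact: measurable_funB.
  - rewrite (_ : (fun t => lne _) = (fun t => if (fine (dQdP t) <= 0)%R then -oo else
        (ln (fine (dQdP t)))%:E)); last first.
      apply/funext => t.
      by rewrite -{1}(fineK (Radon_Nikodym_fin_num t _)).
    apply: measurable_fun_ifT => //.
      by apply: measurable_fun_ler => //; exact: measurableT_comp.
    by apply/measurable_EFinP; do 2 apply: measurableT_comp => //.
  - apply: filterS2 ae_RN ae_RN_gt0 => t -> RNt.
    have RN0 : (0 < fine (RN t))%R by rewrite -lte_fin fineK.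
    rewrite -[in leRHS](fineK (RN_fin t)) lne_EFin// lee_fin.
    have eC : (0 < expR (L t) / C)%R by rewrite divr_gt0// expR_gt0.
    have ut : (0 < u t)%R by rewrite mulr_gt0// invr_gt0.
    have lnu : ln (u t) = (L t - ln C - ln (fine (RN t)))%R.
      rewrite /u lnM ?posrE ?invr_gt0// lnM ?posrE ?invr_gt0 ?expR_gt0//.
      by rewrite expRK !lnV ?posrE.
    have := @le_ln1Dx R (u t - 1)%R; rewrite [(1 + _)%R]addrC subrK lnu.
    by move=> /(_ ltac:(lra)); lra.
have Q1 : Q setT = 1 by exact: probability_setT.
rewrite -leeBlDr//; apply: le_trans key.
rewrite -!EFin_Rintegral//; last first.
  rewrite (_ : _ \o _ = (EFin \o (fun=> 1 - ln C)%R) \+ (EFin \o (fun t => L t - u t)%R)).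
    apply: integrableD => //.
    exact: (bounded_integrable (C := `|1 - ln C|%R) Q1).
  by apply/funext => t /=; rewrite mul1r.
rewrite (Rintegral_affine Q1)// RintegralB// mul1r -EFinB lee_fin.
move: u1; rewrite -EFin_Rintegral// lee_fin; lra.
Qed.

End change_of_measure.

(** * Measurability over a finite action set *)

Section finite_measurability.
Context {R : realType} {K : nat}.

Lemma measurable_action (g : action K -> R) : measurable_fun setT g.
Proof. by move=> _ Y _. Qed.

(** Measurable sections suffice because [g] is a finite sum of sections, each multiplied by the
    indicator of one action. *)
Lemma measurable_action_pair d (T : measurableType d) (g : T * action K -> R) :
  (forall a, measurable_fun setT (fun t => g (t, a))) -> measurable_fun setT g.
Proof.
move=> mg.
rewrite (_ : g = fun ta => \sum_(b : action K) (ta.2 == b)%:R * g (ta.1, b)).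
  apply: measurable_sum => b; apply: measurable_funM.
    exact: (measurableT_comp (measurable_action (fun a => (a == b)%:R)) measurable_snd).
  exact: (measurableT_comp (mg b) measurable_fst).
apply/funext => -[t a] /=.
rewrite (bigD1 a)//= eqxx mul1r big1 ?addr0// => b /negbTE ba.
by rewrite eq_sym ba mul0r.
Qed.

Lemma measurable_eq_action d (T : measurableType d) (g h : T -> action K) :
  measurable_fun setT g -> measurable_fun setT h ->
  measurable_fun setT (fun t => (g t == h t)%:R : R).
Proof.
move=> mg mh.
pose e (ab : action K * action K) : R := (ab.1 == ab.2)%:R.
have me : measurable_fun setT e.
  by apply: measurable_action_pair => b; exact: measurable_action.
have mgh : measurable_fun setT (fun t => (g t, h t)) by exact: measurable_fun_pair.
exact: (measurableT_comp me mgh).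
Qed.

End finite_measurability.

(** * The mixture supermartingale and the bound *)

Section pac_bayes.
Context {R : realType} {dX : measure_display} {X : measurableType dX} {K m : nat}.
Variables (nu : probability X R) (p : R.-pker (X * action K) ~> R).
Hypothesis p_cost : forall x a, p (x, a) [set c : R | -1 <= c <= 0] = 1%E.
Context {dT : measure_display} {Theta : measurableType dT}.
Variable f : Theta -> X -> action K.
Hypothesis mf : measurable_fun setT (fun tx : Theta * X => f tx.1 tx.2).
Variables (pi0 : policy (R := R) X K) (alg : algorithm (R := R) X K m).
Hypothesis pi0_policy : is_policy pi0.
Hypothesis alg_algorithm : is_algorithm alg.
Context {dO : measure_display} {Omega : measurableType dO}.
Variables (Pr : probability Omega R) (z : nat -> 'I_m -> Omega -> sample (R := R) X K).
Hypothesis z_data : sequential_data nu p Pr z pi0 alg.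
Variables (P : probability Theta R) (lambda : R).
Hypothesis lambda_gt0 : 0 < lambda.

Local Notation S := (X * action K * R)%type.
Local Notation H k := (g_sigma_algebraType (past z k)).
Local Notation policy_at := (policy_at z pi0 alg).
Local Notation cost := (mean_cost p).

Let mz k i : measurable_fun setT (z k i).
Proof. by have [+ _] := z_data; exact. Qed.

Let mf1 t : measurable_fun setT (f t).
Proof. exact: (measurableT_comp mf (pair1_measurable t)). Qed.

Definition log_weight k t w (s : S) : R := lambda * predictor_risk nu p (f t) +
  (f t s.1.1 == s.1.2)%:R * ln (1 - lambda * s.2 / policy_at k w s.1.1 s.1.2).

Definition log_martingale k t w : R :=
  \sum_(j < k) \sum_(i < m) log_weight j t w (z j i w).

Let mcost : measurable_fun setT (fun tx : Theta * X => cost (f tx.1 tx.2) tx.2).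
Proof.
have m1 : measurable_fun setT (fun tx : Theta * X => (tx.2, f tx.1 tx.2)).
  exact: measurable_fun_pair.
exact: (measurableT_comp (measurable_mean_cost p_cost) m1).
Qed.

Let nu1 : nu setT = 1%E. Proof. exact: probability_setT. Qed.

Let cost_integrable t : nu.-integrable setT (EFin \o (fun x => cost (f t x) x)).
Proof.
apply: (bounded_integrable (C := 1) nu1).
  exact: (measurableT_comp mcost (pair1_measurable t)).
by move=> x; have /andP[h0 h1] := mean_cost_itv p_cost (f t x) x; rewrite ler_norml;
  apply/andP; split; lra.
Qed.

(** Tonelli's theorem and the measurability it gives are for nonnegative integrands, and costs are
    nonpositive; hence the passage to opposites here and below. *)
Lemma EFin_opp_predictor_risk t :
  (- predictor_risk nu p (f t))%:E = (\int[nu]_x (- cost (f t x) x)%:E)%E.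
Proof.
rewrite /predictor_risk -mulN1r -RintegralZl// EFin_Rintegral.
  by apply: eq_integral => x _; rewrite mulN1r.
rewrite (_ : _ \o _ = (fun x => (-1)%:E * (EFin \o (fun x => cost (f t x) x)) x)%E);
  last by apply/funext.
exact: integrableZl.
Qed.

Lemma predictor_risk_itv t : -1 <= predictor_risk nu p (f t) <= 0.
Proof.
apply: (Rintegral_itv nu1); last by move=> x; exact: mean_cost_itv.
exact: (measurableT_comp mcost (pair1_measurable t)).
Qed.

Let opp_cost_ge0 t x : 0 <= - cost (f t x) x.
Proof. by have /andP[] := mean_cost_itv p_cost (f t x) x; lra. Qed.

Let mopp_cost : measurable_fun setT (fun tx : Theta * X => (- cost (f tx.1 tx.2) tx.2)%:E).
Proof. by apply/measurable_EFinP; exact: measurableT_comp. Qed.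

Lemma measurable_predictor_risk : measurable_fun setT (fun t => predictor_risk nu p (f t)).
Proof.
rewrite (_ : (fun _ => _) = (fun t => - fine (\int[nu]_x (- cost (f t x) x)%:E)%E)).
  apply: measurableT_comp => //; apply: measurableT_comp => //.
  apply: (@measurable_fun_fubini_tonelli_F _ _ _ _ _ nu (fun tx
    => (- cost (f tx.1 tx.2) tx.2)%:E)) => //.
  by move=> tx; rewrite lee_fin.
by apply/funext => t; rewrite -EFin_opp_predictor_risk/= opprK.
Qed.

(** The sum over actions collapses, as the indicator of [f t x = a] selects [cost (f t x) x];
    Tonelli then exchanges the averages over contexts and over [Q]. *)
Lemma risk_policy_of (Q : probability Theta R) :
  risk nu p (policy_of f Q) = \int[Q]_t predictor_risk nu p (f t).
Proof.
have Q1 : Q setT = 1%E by exact: probability_setT.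
have rint : Q.-integrable setT (EFin \o (fun t => predictor_risk nu p (f t))).
  apply: (bounded_integrable (C := 1) Q1); first exact: measurable_predictor_risk.
  by move=> t; have /andP[h0 h1] := predictor_risk_itv t; rewrite ler_norml; apply/andP; split; lra.
have indE x a : Q.-integrable setT (EFin \o (fun t => (f t x == a)%:R)).
  apply: (bounded_integrable (C := 1) Q1).
    apply: measurable_eq_action => //.
    exact: (measurableT_comp mf (pair2_measurable x)).
  by move=> t; case: (_ == _); rewrite ?normr1 ?normr0.
have mcostx x : measurable_fun setT (fun t => cost (f t x) x).
  exact: (measurableT_comp mcost (pair2_measurable x)).
have costQ_int x : Q.-integrable setT (EFin \o (fun t => cost (f t x) x)).
  apply: (bounded_integrable (C := 1) Q1) => // t.
  have /andP[h0 h1] := mean_cost_itv p_cost (f t x) x.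
  by rewrite ler_norml; apply/andP; split; lra.
have opp_costQ x : (\int[Q]_t (- cost (f t x) x)%:E = (- \int[Q]_t cost (f t x) x)%:E)%E.
  rewrite -mulN1r -RintegralZl// EFin_Rintegral.
    by apply: eq_integral => t _; rewrite mulN1r.
  rewrite (_ : _ \o _ = (fun t => (-1)%:E * (EFin \o (fun t => cost (f t x) x)) t)%E);
    last by apply/funext.
  exact: integrableZl.
pose g x := \int[Q]_t cost (f t x) x.
have gE x : \sum_(a : action K) policy_of f Q x a * cost a x = g x.
  apply/eqP; rewrite -eqr_opp; apply/eqP; apply: EFin_inj; rewrite -opp_costQ.
  have cost0 a : (0 <= (- cost a x)%:E)%E.
    by rewrite lee_fin; have /andP[] := mean_cost_itv p_cost a x; lra.
  transitivity (\sum_(a : action K) (- cost a x)%:E * \int[Q]_t ((f t x == a)%:R)%:E)%E.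
    rewrite -sumrN -sumEFin; apply: eq_bigr => a _.
    by rewrite -EFin_Rintegral// -EFinM mulNr mulrC.
  transitivity (\int[Q]_t \sum_(a : action K) ((- cost a x)%:E * ((f t x == a)%:R)%:E))%E.
    have mind a : measurable_fun setT (fun t => ((f t x == a)%:R)%:E : \bar R).
      exact: measurable_int (indE x a).
    rewrite ge0_integral_sum//; last 2 first.
    - by move=> a; apply: emeasurable_funM.
    - by move=> a t _; rewrite mule_ge0// lee_fin.
    by apply: eq_bigr => a _; rewrite ge0_integralZl// => t _; rewrite lee_fin.
  apply: eq_integral => t _; rewrite (bigD1 (f t x))//= eqxx mule1 big1 ?adde0// => a.
  by rewrite eq_sym => /negbTE ->; rewrite mule0.
have g_itv x : -1 <= g x <= 0.
  by apply: (Rintegral_itv Q1) => // t; exact: mean_cost_itv.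
have mg : measurable_fun setT g.
  rewrite (_ : g = fun x => - fine (\int[Q]_t (- cost (f t x) x)%:E)%E).
    apply: measurableT_comp => //; apply: measurableT_comp => //.
    apply: (@measurable_fun_fubini_tonelli_G _ _ _ _ _ Q (fun tx
      => (- cost (f tx.1 tx.2) tx.2)%:E)) => //.
    by move=> tx; rewrite lee_fin.
  by apply/funext => x; rewrite opp_costQ opprK.
have g_int : nu.-integrable setT (EFin \o g).
  apply: (bounded_integrable (C := 1) nu1) => // x.
  by have /andP[h0 h1] := g_itv x; rewrite ler_norml; apply/andP; split; lra.
apply/eqP; rewrite -eqr_opp; apply/eqP; apply: EFin_inj.
transitivity (\int[nu]_x \int[Q]_t (- cost (f t x) x)%:E)%E.
  under eq_integral do rewrite opp_costQ.
  rewrite /risk; under eq_Rintegral do rewrite gE.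
  rewrite -mulN1r -RintegralZl// EFin_Rintegral.
    by apply: eq_integral => x _; rewrite mulN1r.
  rewrite (_ : _ \o _ = (fun x => (-1)%:E * (EFin \o g) x)%E); last by apply/funext.
  exact: integrableZl.
transitivity (\int[Q]_t \int[nu]_x (- cost (f t x) x)%:E)%E.
  apply/esym.
  by apply: (@fubini_tonelli _ _ _ _ _ Q nu (fun tx => (- cost (f tx.1 tx.2) tx.2)%:E)) => //
    tx; rewrite lee_fin.
under eq_integral do rewrite -EFin_opp_predictor_risk.
rewrite -mulN1r -RintegralZl// EFin_Rintegral.
  by apply: eq_integral => t _; rewrite mulN1r.
rewrite (_ : _ \o _ = (fun t => (-1)%:E * (EFin \o (fun t => predictor_risk nu p (f t))) t)%E);
  last by apply/funext.
exact: integrableZl.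
Qed.

Let measurable_log_weight k : measurable_fun setT
  (fun y : Theta * (H k * S) => log_weight k y.1 y.2.1 y.2.2).
Proof.
have m2 : measurable_fun setT (fun y : Theta * (H k * S) => y.2.2).
  exact: (measurableT_comp measurable_snd measurable_snd).
have mx : measurable_fun setT (fun y : Theta * (H k * S) => y.2.2.1.1).
  exact: (measurableT_comp measurable_fst (measurableT_comp measurable_fst m2)).
have ma : measurable_fun setT (fun y : Theta * (H k * S) => y.2.2.1.2).
  exact: (measurableT_comp measurable_snd (measurableT_comp measurable_fst m2)).
have mc : measurable_fun setT (fun y : Theta * (H k * S) => y.2.2.2).
  exact: (measurableT_comp measurable_snd m2).
have mw : measurable_fun setT (fun y : Theta * (H k * S) => y.2.1).
  exact: (measurableT_comp measurable_fst measurable_snd).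
apply: measurable_funD.
  apply: measurable_funM => //.
  exact: (measurableT_comp measurable_predictor_risk measurable_fst).
apply: measurable_funM.
  apply: measurable_eq_action => //.
  have mtx : measurable_fun setT (fun y : Theta * (H k * S) => (y.1, y.2.2.1.1)).
    exact: measurable_fun_pair.
  exact: (measurableT_comp mf mtx).
apply: measurableT_comp => //; apply: measurable_funB => //.
apply: measurable_funM; first exact: measurable_funM.
apply: (measurableT_comp (@measurable_inv R)).
pose pi (wxa : H k * X * action K) := policy_at k wxa.1.1 wxa.1.2 wxa.2.
have mpi : measurable_fun setT pi.
  by apply: measurable_action_pair => a; exact: measurable_policy_at.
have mwxa : measurable_fun setT (fun y : Theta * (H k * S) => (y.2.1, y.2.2.1.1, y.2.2.1.2)).
  by apply: measurable_fun_pair => //; exact: measurable_fun_pair.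
exact: (measurableT_comp mpi mwxa).
Qed.

Let measurable_log_martingale k : measurable_fun setT
  (fun tw : Theta * H k => log_martingale k tw.1 tw.2).
Proof.
elim: k => [|k IH].
  by under eq_fun do rewrite /log_martingale big_ord0; exact: measurable_cst.
under eq_fun do rewrite /log_martingale big_ord_recr/=.
have mid : measurable_fun setT (fun tw : Theta * H k.+1 => tw.2 : H k).
  exact: (measurableT_comp (@measurable_id_past _ _ _ _ _ _ _ z k) measurable_snd).
apply: measurable_funD.
  have m1 : measurable_fun setT (fun tw : Theta * H k.+1 => (tw.1, tw.2 : H k)).
    exact: measurable_fun_pair.
  exact: (measurableT_comp IH m1).
apply: measurable_sum => i.
have m2 : measurable_fun setT (fun tw : Theta * H k.+1 => (tw.1, (tw.2 : H k, z k i tw.2))).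
  apply: measurable_fun_pair => //; apply: measurable_fun_pair => //.
  exact: (measurableT_comp (@sample_past _ _ _ _ _ _ _ z k i) measurable_snd).
exact: (measurableT_comp (@measurable_log_weight k) m2).
Qed.

Definition mixture k w : \bar R := (\int[P]_t (expR (log_martingale k t w))%:E)%E.

Let mexp k : measurable_fun setT
  (fun tw : Theta * H k => (expR (log_martingale k tw.1 tw.2))%:E).
Proof. by apply/measurable_EFinP; apply: measurableT_comp. Qed.

Let measurable_mixture k : measurable_fun setT (mixture k : H k -> \bar R).
Proof.
apply: (@measurable_fun_fubini_tonelli_G _ _ _ _ _ P
  (fun tw : Theta * H k => (expR (log_martingale k tw.1 tw.2))%:E)) => //.
Qed.

Let mixture_ge0 k w : (0 <= mixture k w)%E.
Proof. by apply: integral_ge0 => t _; rewrite lee_fin expR_ge0. Qed.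

Lemma mixture0 w : mixture 0 w = 1%E.
Proof.
rewrite /mixture; under eq_integral do rewrite /log_martingale big_ord0 expR0.
by rewrite integral_cst// mul1e; exact: probability_setT.
Qed.

Let past_meas k : past z k `<=` measurable := @past_measurable _ _ _ _ _ _ _ z mz k.

Let mid_past k : measurable_fun setT (id : Omega -> H k).
Proof. exact: measurable_id_g_sigma. Qed.

(** Testing on past events [A] expresses the supermartingale property without a conditional
    expectation. Tonelli moves the prior outside; for fixed [t] the indicator of [A] is absorbed
    into the past factor of [batch_supermartingale]. *)
Lemma mixture_supermartingale k A : past z k A ->
  (\int[Pr]_w ((\1_A w)%:E * mixture k.+1 w) <= \int[Pr]_w ((\1_A w)%:E * mixture k w))%E.
Proof.
move=> kA; have mA := past_meas kA.
pose F j (tw : Theta * Omega) : \bar R := (\1_A tw.2 * expR (log_martingale j tw.1 tw.2))%:E.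
have F0 j tw : (0 <= F j tw)%E by rewrite lee_fin mulr_ge0// expR_ge0.
have mF j : measurable_fun setT (F j).
  have m1 : measurable_fun setT (fun tw : Theta * Omega => (tw.1, tw.2 : H j)).
    apply: measurable_fun_pair => //.
    exact: (measurableT_comp (@mid_past j) measurable_snd).
  apply/measurable_EFinP; apply: measurable_funM.
    exact: (measurableT_comp (measurable_indic mA) measurable_snd).
  apply: measurableT_comp => //.
  exact: (measurableT_comp (@measurable_log_martingale j) m1).
have swap j : (\int[Pr]_w ((\1_A w)%:E * mixture j w) = \int[P]_t \int[Pr]_w F j (t, w))%E.
  rewrite (@fubini_tonelli _ _ _ _ _ P Pr (F j))//; apply: eq_integral => w _.
  rewrite /mixture -ge0_integralZl//.
  exact: (measurableT_comp (@mexp j) (pair2_measurable (w : H j))).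
rewrite !swap; apply: ge0_le_integral.
- by [].
- by move=> t _; apply: integral_ge0.
- by apply: measurable_fun_fubini_tonelli_F.
- by apply: measurable_fun_fubini_tonelli_F.
move=> t _.
have [_ /(_ k)[ind law]] := z_data.
pose M w : R := \1_A w * expR (log_martingale k t w).
pose Phi (ws : Omega * S) := expR (log_weight k t ws.1 ws.2).
have -> : (\int[Pr]_w F k.+1 (t, w) =
    \int[Pr]_w (M w * \prod_(i < m) Phi (w, z k i w))%:E)%E.
  apply: eq_integral => w _; congr (_%:E).
  by rewrite /M /Phi -mulrA -expR_sum -expRD /log_martingale big_ord_recr.
have mPhi : measurable_fun setT (Phi : H k * S -> R).
  apply: measurableT_comp => //.
  exact: (measurableT_comp (@measurable_log_weight k) (pair1_measurable t)).
apply: (@batch_supermartingale _ _ _ _ _ nu p _ _ Pr (past z k) (@past_meas k) _ (policy_at k)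
  (z k)) => //.
- exact: past_sigma_algebra.
- by move=> a; exact: measurable_policy_at.
- by move=> w; exact: policy_at_policy.
- apply: measurable_funM.
    by apply: measurable_indic; exact: sub_sigma_algebra.
  apply: measurableT_comp => //.
  exact: (measurableT_comp (@measurable_log_martingale k) (pair1_measurable t)).
- by move=> w; rewrite mulr_ge0// expR_ge0.
- by move=> ws; exact: expR_ge0.
- move=> w; apply: bandit_integral_exp_weight => //; last exact: ltW.
  exact: policy_at_policy.
Qed.

(* V n below is the expected value of the mixture stopped when it first exceeds C,
   with the stopped value replaced by C; it is nonincreasing in n. *)
Lemma mixture_ville (C : R) : 1 <= C ->
  exists E : set Omega, [/\ measurable E, ((1 - C^-1)%:E <= Pr E)%E &
    forall w, E w -> forall k, (mixture k.+1 w <= C%:E)%E].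
Proof.
move=> C1; have C0 : 0 < C by lra.
(* [A n] is the event that the mixtures 1 to [n] stay at most [C]; index 0 is left out, [mixture 0]
   being constantly 1. *)
pose fix A n := if n is k.+1 then A k `&` [set w | (mixture k.+1 w <= C%:E)%E] else setT.
have mixm k B : past z k B -> measurable (B : set (H k)) by exact: sub_sigma_algebra.
have pastE k (B : set Omega) : measurable (B : set (H k)) -> past z k B.
  by rewrite /measurable/= (sigma_algebra_id (@past_sigma_algebra _ _ _ _ _ _ _ z k)).
have pA n : past z n (A n).
  elim: n => [|n IH]; first by right.
  apply: (pastE n.+1 (A n `&` [set w | (mixture n.+1 w <= C%:E)%E])).
  have mAn : measurable (A n : set (H n.+1)).
    by apply: mixm; apply: past_succ; exact: IH.
  apply: measurableI; first exact: mAn.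
  rewrite -[X in measurable X]setTI.
  by apply: emeasurable_fun_infty_c => //; exact: measurable_mixture.
have mA n : measurable (A n) by exact: past_meas (pA n).
have mmix k : measurable_fun setT (mixture k).
  exact: (measurableT_comp (@measurable_mixture k) (@mid_past k)).
pose V n (g : Omega -> \bar R) := (\int[Pr]_w ((\1_(A n) w)%:E * g w) + C%:E * Pr (~` A n))%E.
have mV n (g : Omega -> \bar R) : measurable_fun setT g ->
    measurable_fun setT (fun w => (\1_(A n) w)%:E * g w + C%:E * (\1_(~` A n) w)%:E)%E.
  move=> mg; apply: emeasurable_funD; apply: emeasurable_funM => //; apply/measurable_EFinP.
    exact: measurable_indic.
  by apply: measurable_indic; exact: measurableC.
have VE n g : measurable_fun setT g -> (forall w, 0 <= g w)%E ->
    V n g = (\int[Pr]_w ((\1_(A n) w)%:E * g w + C%:E * (\1_(~` A n) w)%:E))%E.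
  move=> mg g0; rewrite ge0_integralD//; last 4 first.
  - by move=> w _; rewrite mule_ge0// lee_fin.
  - by apply: emeasurable_funM => //; exact/measurable_EFinP.
  - by move=> w _; rewrite mule_ge0// lee_fin// ltW.
  - apply: emeasurable_funM => //; apply/measurable_EFinP; apply: measurable_indic;
    exact: measurableC.
  rewrite ge0_integralZl//; last 2 first.
  - by apply/measurable_EFinP; apply: measurable_indic; exact: measurableC.
  - by rewrite lee_fin ltW.
  by rewrite integral_indic ?setIT//; exact: measurableC.
have V1 n : (V n (mixture n) <= 1)%E.
  elim: n => [|n IH].
    rewrite /V /= setCT measure0 mule0 adde0.
    under eq_integral do rewrite indicT mul1e mixture0.
    by rewrite integral_cst// mul1e; rewrite [leLHS]probability_setT.
  (* Two moves: on the past event [A n] the supermartingale property advances the mixture; then the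
     points of [A n] where it exceeds [C] are stopped, which lowers their value to [C]. *)
  apply: le_trans IH; apply: (@le_trans _ _ (V n (mixture n.+1))); last first.
    by apply: leeD2r; exact: (mixture_supermartingale (pA n)).
  rewrite !VE//; apply: ge0_le_integral => //.
  - move=> w _; rewrite adde_ge0// mule_ge0// ?lee_fin// ltW//.
  - exact: mV.
  - exact: mV.
  - move=> w _ /=; rewrite !indicE !in_setC in_setI.
    have [wA|wA] := boolP (w \in A n) => /=; last by rewrite mul0e.
    have [wN|wN] := boolP (w \in _) => //=.
    rewrite !mule0 mul0e mul1e mule1 adde0 add0e.
    by move: wN; rewrite notin_setE /= => /negP; rewrite -ltNge => /ltW.
have PA n : ((1 - C^-1)%:E <= Pr (A n))%E.
  (* Markov's inequality in disguise: the stopped part of [V n] alone is [C] times this probability,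
     and [V n] is at most 1. *)
  have PC : (Pr (~` A n) <= C^-1%:E)%E.
    rewrite -[leRHS]mule1 lee_pdivlMl//; apply: le_trans (V1 n).
    rewrite /V leeDr//; apply: integral_ge0 => w _.
    by rewrite mule_ge0// lee_fin.
  rewrite -[A n]setCK probability_setC//; last exact: measurableC.
  by rewrite EFinB leeB.
exists (\bigcap_n A n); split.
- exact: bigcap_measurableType.
- have cvgA : Pr (A n) @[n --> \oo] --> Pr (\bigcap_n A n).
    apply: nonincreasing_cvg_mu => //.
    + by rewrite (le_lt_trans (probability_le1 _ _))// ltry.
    + exact: bigcap_measurableType.
    + by apply/nonincreasing_seqP => n; apply/subsetPset => w [].
  by apply: (cvge_ge _ cvgA); exact: nearW.
- by move=> w Ew k; have [] := Ew k.+1 Logic.I.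
Qed.

(** For fixed data the log-weights are affine in the indicators of [f t x = a], whose [Q]-means are
    the probabilities of [policy_of f Q]. The index is [k.+1] because the estimator at [k] uses the
    batches 0 to [k]. *)
Lemma log_martingaleE k w (Q : probability Theta R) : (0 < m)%N ->
  Q.-integrable setT (EFin \o (fun t => log_martingale k.+1 t w)) /\
  \int[Q]_t log_martingale k.+1 t w = lambda * (k.+1 * m)%:R *
    (risk nu p (policy_of f Q) - LS_estimator z pi0 alg lambda k w (policy_of f Q)).
Proof.
move=> m0; have Q1 : Q setT = 1%E by exact: probability_setT.
have rint : Q.-integrable setT (EFin \o (fun t => predictor_risk nu p (f t))).
  apply: (bounded_integrable (C := 1) Q1); first exact: measurable_predictor_risk.
  by move=> t; have /andP[h0 h1] := predictor_risk_itv t; rewrite ler_norml; apply/andP; split; lra.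
have ind_int x a : Q.-integrable setT (EFin \o (fun t => (f t x == a)%:R)).
  apply: (bounded_integrable (C := 1) Q1).
    apply: measurable_eq_action => //.
    exact: (measurableT_comp mf (pair2_measurable x)).
  by move=> t; case: (_ == _); rewrite ?normr1 ?normr0.
pose l j (s : S) := ln (1 - lambda * s.2 / policy_at j w s.1.1 s.1.2).
have scale_int (c : R) (g : Theta -> R) : Q.-integrable setT (EFin \o g) ->
    Q.-integrable setT (EFin \o (fun t => c * g t)).
  move=> gi; rewrite (_ : _ \o _ = (fun t => c%:E * (EFin \o g) t)%E); last by apply/funext.
  exact: integrableZl.
have add_int (g h : Theta -> R) : Q.-integrable setT (EFin \o g) ->
    Q.-integrable setT (EFin \o h) -> Q.-integrable setT (EFin \o (fun t => g t + h t)).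
  move=> gi hi; rewrite (_ : _ \o _ = (EFin \o g) \+ (EFin \o h))%E; last by apply/funext.
  exact: integrableD.
have sum_int (I : finType) (g : I -> Theta -> R) :
    (forall i, Q.-integrable setT (EFin \o g i)) ->
    Q.-integrable setT (EFin \o (fun t => \sum_i g i t)) /\
    \int[Q]_t (\sum_i g i t) = \sum_i \int[Q]_t g i t.
  move=> gi; elim: (index_enum I) => [|i r [IHi IHe]].
    rewrite (_ : (fun t => _) = fun=> 0); last by apply/funext => t; rewrite big_nil.
    rewrite big_nil (Rintegral_prob_cst Q1); split => //.
    by apply: (bounded_integrable (C := 0) Q1) => // t; rewrite normr0.
  rewrite (_ : (fun t => _) = fun t => g i t + \sum_(j <- r) g j t); last first.
    by apply/funext => t; rewrite big_cons.
  by rewrite big_cons -IHe RintegralD//; split => //; exact: add_int.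
have lw j (s : S) : Q.-integrable setT (EFin \o (fun t => log_weight j t w s)) /\
    \int[Q]_t log_weight j t w s =
    lambda * risk nu p (policy_of f Q) + policy_of f Q s.1.1 s.1.2 * l j s.
  have i1 := scale_int lambda _ rint.
  have i2 : Q.-integrable setT (EFin \o (fun t => (f t s.1.1 == s.1.2)%:R * l j s)).
    under eq_fun do rewrite mulrC; exact: scale_int.
  split; first exact: add_int.
  rewrite RintegralD// RintegralZl// risk_policy_of; congr (_ + _).
  by rewrite RintegralZr.
have [int_j E_j] := sum_int 'I_k.+1 (fun j t => \sum_(i < m) log_weight j t w (z j i w))
  (fun j => (sum_int 'I_m (fun i t => log_weight j t w (z j i w)) (fun i => (lw _ _).1)).1).
split; first exact: int_j.
rewrite [LHS]E_j.
under eq_bigr => j _.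
  rewrite (sum_int 'I_m (fun i t => log_weight j t w (z j i w)) (fun i => (lw _ _).1)).2.
  under eq_bigr do rewrite (lw _ _).2.
  rewrite big_split/= sumr_const card_ord.
  over.
rewrite big_split/= sumr_const card_ord.
set n := (k.+1 * m)%:R : R; have n0 : n != 0 by rewrite pnatr_eq0 muln_eq0/= -lt0n.
rewrite /LS_estimator -/n mulrBr; congr (_ + _).
  by rewrite -mulrnA mulnC -mulr_natr -/n; ring.
rewrite mulNr mulrN opprK mulrA mulfK// mulr_sumr; apply: eq_bigr => j _.
rewrite mulr_sumr; apply: eq_bigr => i _.
rewrite /l; case: (z j i w) => -[x a] c /=.
by field; rewrite gt_eqF.
Qed.

Lemma pac_bayes_bound (delta : R) : (0 < m)%N -> 0 < delta -> delta <= 1 ->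
  exists E : set Omega,
    [/\ measurable E, ((1 - delta)%:E <= Pr E)%E &
        forall w, E w -> forall (k : nat) (Q : probability Theta R),
          ((risk nu p (policy_of f Q))%:E <=
           (LS_estimator z pi0 alg lambda k w (policy_of f Q))%:E +
           (KL Q P + (ln (1 / delta))%:E) *
           ((lambda * (k.+1 * m)%:R)^-1)%:E)%E].
Proof.
move=> m0 d0 d1.
have C1 : 1 <= 1 / delta by rewrite ler_pdivlMr// mul1r.
(* The threshold [1 / delta] makes [1 - C^-1] equal to [1 - delta], and [E] is obtained before [k]
   and [Q] are introduced. *)
have [E [mE PE EN]] := mixture_ville C1.
exists E; split => //; first by move: PE; rewrite div1r invrK.
move=> w Ew k Q.
have n0 : 0 < lambda * (k.+1 * m)%:R by rewrite mulr_gt0// ltr0n muln_gt0.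
rewrite /KL; case: ifPn => [/asboolP QP|_]; last first.
  (* Without absolute continuity the right-hand side is [+oo], since the factor multiplying the
     divergence is positive. *)
  by rewrite addye// gt0_mulye ?lte_fin ?invr_gt0// addey// leey.
have [Li LE] := log_martingaleE k w Q m0.
have mL : measurable_fun setT (fun t => log_martingale k.+1 t w).
  exact: (measurableT_comp (@measurable_log_martingale k.+1) (pair2_measurable (w : H k.+1))).
have := donsker_varadhan QP mL Li (lt_le_trans ltr01 C1) (EN w Ew k).
rewrite -EFin_Rintegral// LE => DV.
set rsk := risk nu p _ in DV *; set LS := LS_estimator _ _ _ _ _ _ _ in DV *.
rewrite -leeBlDl//.
apply: le_trans (lee_wpmul2r _ DV); last by rewrite lee_fin invr_ge0 ltW.
by rewrite -EFinM -EFinB lee_fin mulrAC mulfV ?mul1r// gt_eqF.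
Qed.

End pac_bayes.

Theorem theorem3p2 (R : realType) (d K m : nat)
    (X : set 'rV[R]_d) (X0 : X !=set0) (Xcompact : compact X)
    (nu : probability (borel X0) R)
    (p : R.-pker (borel X0 * action K) ~> R)
    (p_cost : forall x a, p (x, a) [set c : R | -1 <= c <= 0] = 1%E)
    (dT : measure_display) (Theta : measurableType dT)
    (f : Theta -> borel X0 -> action K)
    (mf : measurable_fun setT (fun tx : Theta * borel X0 => f tx.1 tx.2))
    (pi0 : policy (borel X0) K) (pi0_policy : is_policy pi0)
    (alg : algorithm (borel X0) K m) (alg_algorithm : is_algorithm alg)
    (m_gt0 : (0 < m)%N)
    (dO : measure_display) (Omega : measurableType dO)
    (Pr : probability Omega R)
    (z : nat -> 'I_m -> Omega -> sample (borel X0) K)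
    (z_data : sequential_data nu p Pr z pi0 alg)
    (P : probability Theta R)
    (lambda delta : R) (lambda_gt0 : 0 < lambda)
    (delta_gt0 : 0 < delta) (delta_le1 : delta <= 1) :
  exists E : set Omega,
    [/\ measurable E,
        ((1 - delta)%:E <= Pr E)%E &
        forall w, E w ->
        forall (k : nat) (Q : probability Theta R),
          ((risk nu p (policy_of f Q))%:E <=
           (LS_estimator z pi0 alg lambda k w (policy_of f Q))%:E +
           (KL Q P + (ln (1 / delta))%:E) *
           ((lambda * (k.+1 * m)%:R)^-1)%:E)%E].
Proof. exact: (pac_bayes_bound p_cost mf pi0_policy alg_algorithm z_data). Qed.
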